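(* Let $L$ be an oriented virtual knot and let $(X,f,R)$ be a finite virtual biquandle, with $R=(R_1,R_2)$. Let $VR\colon X\times X\to X\times X$ be given by $VR(x,y)=\big(R_1(x,f(y)),\,R_2(f^{-1}(x),y)\big)$ (so that $(X,VR)$ is a biquandle). Then the number of colorings of $L$ by $(X,f,R)$ under the virtual biquandle coloring rule is equal to the number of colorings of $L$ by $(X,VR)$ under the biquandle coloring rule.
   Context: A biquandle is a non-empty set $X$ with a map $R\colon X\times X\to X\times X$, $R(x,y)=(R_1(x,y),R_2(x,y))$, such that: (1) $(R\times \mathrm{id})(\mathrm{id}\times R)(R\times \mathrm{id})=(\mathrm{id}\times R)(R\times \mathrm{id})(\mathrm{id}\times R)$ on $X^3$; (2) $R$ is invertible; (3) for any $x,z\in X$ there is a unique $y\in X$ with $R_1(x,y)=z$; (4) for any $y,w\in X$ there is a unique $x\in X$ with $R_2(x,y)=w$; (5) for any $a\in X$ there is a unique $x\in X$ with $R(x,a)=(x,a)$. A virtual biquandle is a triple $(X,f,R)$ where $(X,R)$ is a biquandle and $f\colon X\to X$ is an automorphism of it, i.e. a bijection with $(f\times f)\circ R=R\circ (f\times f)$. It is finite if $X$ is finite. Write $R^{-1}=(\overline{R_1},\overline{R_2})$. It is known that $(X,VR)$ is a biquandle. A virtual link diagram is a generic immersion of finitely many circles in the plane $\mathbb{R}^2$ or the sphere $\mathbb{S}^2$ whose double points are each decorated either as a classical crossing (with over/under information) or as a virtual crossing (no such information). It is oriented if each circle is oriented. An (oriented) virtual link is an equivalence class of (oriented) diagrams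 under planar isotopy and the generalized Reidemeister moves: the classical Reidemeister moves I, II, III; the same three moves with all crossings virtual; and the mixed move in which a strand having two consecutive virtual crossings passes across a classical crossing. A virtual knot is a virtual link with one component. A semiarc is an arc of a diagram between two consecutive double points (classical or virtual); a component without double points is a single semiarc. At each crossing, rotate the picture in the plane so that both strands point downward; call the incoming semiarcs top-left and top-right, and the outgoing ones bottom-left and bottom-right. A classical crossing is positive if the over-strand runs from top-right to bottom-left, and negative if the over-strand runs from top-left to bottom-right. Virtual biquandle coloring rule: a coloring by $(X,f,R)$ of a diagram is an assignment of elements of $X$ to its semiarcs such that at each crossing, if the top-left label is $x$ and the top-right label is $y$, then the (bottom-left, bottom-right) labels are: $(R_1(x,y),R_2(x,y))$ at a positive crossing; $(\overline{R_1}(x,y),\overline{R_2}(x,y))$ at a negative crossing; $(f^{-1}(y),f(x))$ at a virtual crossing. Biquandle coloring rule: a coloring by a biquandle $(X,S)$, with $S=(S_1,S_2)$ and $S^{-1}=(\overline{S_1},\overline{S_2})$, is an assignment of elements of $X$ to the semiarcs such that, with the same notation, the (bottom-left, bottom-right) labels are: $(S_1(x,y),S_2(x,y))$ at a positive crossing; $(\overline{S_1}(x,y),\overline{S_2}(x,y))$ at a negative crossing; $(y,x)$ at a virtual crossing. Here it is used with $S=VR$. Colorings of a virtual knot $L$ mean colorings of any diagram representing $L$; it is known that the number of colorings, for either rule, does not depend on the diagram. *)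

(* Defs.v *)
From HB Require Import structures.
From mathcomp Require Import all_boot all_order all_algebra.
From mathcomp Require Import all_classical all_reals all_analysis.

Set Implicit Arguments.
Unset Strict Implicit.
Unset Printing Implicit Defensive.
Import Order.TTheory GRing.Theory Num.Theory.
Import numFieldNormedType.Exports.
Local Open Scope classical_set_scope.
Local Open Scope ring_scope.

Definition map_fst_pair (X : Type) (S : X * X -> X * X) (t : X * X * X) :=
  (S (t.1.1, t.1.2), t.2).

Definition map_snd_pair (X : Type) (S : X * X -> X * X) (t : X * X * X) :=
  let p := S (t.1.2, t.2) in (t.1.1, p.1, p.2).

Record biquandle (X : Type) (S : X * X -> X * X) : Prop := Biquandle {
  biq_nonempty : inhabited X;
  biq_braid :
    map_fst_pair S \o map_snd_pair S \o map_fst_pair S =1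
    map_snd_pair S \o map_fst_pair S \o map_snd_pair S;
  biq_invertible : bijective S;
  biq_right : forall x z, exists! y, (S (x, y)).1 = z;
  biq_left : forall y w, exists! x, (S (x, y)).2 = w;
  biq_diag : forall a, exists! x, S (x, a) = (x, a) }.

Record virtual_biquandle (X : Type) (f : X -> X) (S : X * X -> X * X) : Prop :=
  VirtualBiquandle {
  vbiq_biquandle : biquandle S;
  vbiq_bij : bijective f;
  vbiq_morph : forall x y,
    (f (S (x, y)).1, f (S (x, y)).2) = S (f x, f y) }.

(* [finv g] is the inverse of [g] when [g] is an injective self-map of a
   finite type. *)
Definition VR (X : finType) (f : X -> X) (S : X * X -> X * X) (p : X * X) :=
  ((S (p.1, f p.2)).1, (S (finv f p.1, p.2)).2).

Lemma vbiq_morph_inv (X : finType) (f : X -> X) (S : X * X -> X * X) :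
  virtual_biquandle f S ->
  forall x y, (finv f (S (x, y)).1, finv f (S (x, y)).2) =
              S (finv f x, finv f y).
Proof.
case=> _ /bij_inj fI fS x y; have fK := finv_f fI; have Kf := f_finv fI.
have := fS (finv f x) (finv f y); rewrite !Kf.
by case: (S (x, y)) => a b [<- <-] /=; rewrite !fK; case: (S _).
Qed.

Lemma VR_biquandle (X : finType) (f : X -> X) (S : X * X -> X * X) :
  virtual_biquandle f S -> biquandle (VR f S).
Proof.
move=> hX; have [[X0 brS [S' SK KS] rS lS dS] fbij fS] := hX.
have fI := bij_inj fbij; have fK := finv_f fI; have Kf := f_finv fI.
have VRE p : VR f S p = ((S (p.1, f p.2)).1, finv f (S (p.1, f p.2)).2).
  by rewrite /VR -{2}(fK p.2) -vbiq_morph_inv.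
split=> //.
- pose F (t : X * X * X) := (t.1.1, f t.1.2, f (f t.2)).
  have FI : injective F.
    by move=> [[x y] z] [[x' y'] z'] [-> /fI-> /fI/fI->].
  have F1 t : F (map_fst_pair (VR f S) t) = map_fst_pair S (F t).
    rewrite /map_fst_pair VRE /F /= Kf; by case: (S _).
  have F2 t : F (map_snd_pair (VR f S) t) = map_snd_pair S (F t).
    rewrite /map_snd_pair VRE /F /= Kf -fS /=; by case: (S _).
  move=> t; apply: FI; rewrite /comp !(F1, F2).
  exact: (brS (F t)).
- exists (fun p => let q := S' (p.1, f p.2) in (q.1, finv f q.2)) => [[x y]|[x y]].
    by rewrite VRE /= Kf -surjective_pairing SK /= fK.
  by rewrite VRE /= Kf -surjective_pairing KS /= fK.
- move=> x z; have [y [yz uy]] := rS x z; exists (finv f y); split.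
    by rewrite /VR /= Kf.
  by move=> y' /= /uy ->; rewrite fK.
- move=> y w; have [x [xw ux]] := lS y w; exists (f x); split.
    by rewrite /VR /= fK.
  by move=> x' /= /ux ->; rewrite Kf.
- move=> a; have [x [xa ux]] := dS (f a); exists x; split.
    by rewrite VRE /= xa /= fK.
  move=> x'; rewrite VRE /= => -[e1 e2]; apply: ux.
  by rewrite [LHS]surjective_pairing e1 -[(S _).2]Kf e2.
Qed.

(* Both surfaces are taken inside R^3: the plane is z = 0 with upward normal,
   the sphere is the unit sphere with outward normal. *)
Variant surface := Plane | Sphere.

Definition on_surface (R : realType) (F : surface) (p : 'rV[R]_3) : Prop :=
  match F with
  | Plane => p 0 ord_max = 0
  | Sphere => \sum_i p 0 i ^+ 2 = 1
  end.

Definition normal (R : realType) (F : surface) (p : 'rV[R]_3) : 'rV[R]_3 :=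
  match F with
  | Plane => delta_mx 0 ord_max
  | Sphere => p
  end.

(* For tangent vectors u, v at p: positive iff (u, v) is a positively oriented
   basis of the tangent plane, zero iff u and v are linearly dependent. *)
Definition orientation (R : realType) (F : surface) (p u v : 'rV[R]_3) : R :=
  \det (\matrix_(i < 3) [:: normal F p; u; v]`_i).

Variant level := Over | Under | Virt.

Definition opposite_level (l : level) :=
  match l with Over => Under | Under => Over | Virt => Virt end.

(* An oriented diagram with one component: a generic smooth immersion of the
   circle R/Z, given as a 1-periodic map, with its decorated double points.
   [param] lists in increasing order the parameters in [0, 1) of the double
   points, so every double point occurs at two indices, one for each strand;
   [strand i] tells how the strand at index [i] passes through. *)
Record knot_diagram (R : realType) := KnotDiagram {
  surf : surface;
  curve : R -> 'rV[R]_3;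
  nparam : nat;
  param : 'I_nparam -> R;
  strand : 'I_nparam -> level;
  curve_on_surface : forall t, on_surface surf (curve t);
  curve_periodic : forall t, curve (t + 1) = curve t;
  curve_smooth : forall n t, derivable (derive1n n curve) t 1;
  curve_immersed : forall t, derive1 curve t != 0;
  param_range : forall i, 0 <= param i < 1;
  param_increasing : forall i j : 'I_nparam, (i < j)%N -> param i < param j;
  param_double : forall t, 0 <= t < 1 ->
    (exists i, param i = t) <->
    (exists s, [/\ 0 <= s < 1, s != t & curve s = curve t]);
  no_triple_point : forall i j k,
    curve (param i) = curve (param j) -> curve (param j) = curve (param k) ->
    [\/ i = j, j = k | i = k];
  transverse : forall i j, i != j -> curve (param i) = curve (param j) ->
    orientation surf (curve (param i))
      (derive1 curve (param i)) (derive1 curve (param j)) != 0;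
  strand_opposite : forall i j,
    i != j -> curve (param i) = curve (param j) ->
    strand j = opposite_level (strand i) }.

(* For nparam > 0, semiarc i runs from param i to the cyclically next
   parameter; for nparam = 0 the whole circle is the only semiarc. *)
Definition semiarc (R : realType) (D : knot_diagram R) : finType :=
  'I_(maxn (nparam D) 1).

Definition out_arc (R : realType) (D : knot_diagram R) (i : 'I_(nparam D)) :
  semiarc D := widen_ord (leq_maxl _ _) i.

Definition in_arc (R : realType) (D : knot_diagram R) (i : 'I_(nparam D)) :
  semiarc D := out_arc (ord_pred i).

(* With both strands pointing downward, the directions (-1, -1) and (1, -1)
   form a positive basis: the strand at i goes from top-right to bottom-left
   and the strand at j from top-left to bottom-right. *)
Definition crossing (R : realType) (D : knot_diagram R) (i j : 'I_(nparam D)) :=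
  [&& i != j, curve D (param i) == curve D (param j) &
      0 < orientation (surf D) (curve D (param i))
            (derive1 (curve D) (param i)) (derive1 (curve D) (param j))].

Variant crossing_type := Positive | Negative | Virtual.

(* [l] is the level of the strand from top-right to bottom-left. *)
Definition type_of_level (l : level) :=
  match l with Over => Positive | Under => Negative | Virt => Virtual end.

(* A rule sends the (top-left, top-right) labels of a crossing of the given
   type to its (bottom-left, bottom-right) labels. *)
Definition coloring (R : realType) (D : knot_diagram R) (X : finType)
    (rule : crossing_type -> X * X -> X * X) (c : {ffun semiarc D -> X}) :=
  [forall i, forall j, crossing i j ==>
     ((c (out_arc i), c (out_arc j)) ==
      rule (type_of_level (strand i)) (c (in_arc j), c (in_arc i)))].

Definition num_colorings (R : realType) (D : knot_diagram R) (X : finType)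
    (rule : crossing_type -> X * X -> X * X) : nat :=
  #|[set c : {ffun semiarc D -> X} | coloring rule c]|.

Definition virtual_biquandle_rule (X : finType) (f : X -> X)
    (S : X * X -> X * X) (k : crossing_type) (p : X * X) : X * X :=
  match k with
  | Positive => S p
  | Negative => finv S p
  | Virtual => (finv f p.2, f p.1)
  end.

Definition biquandle_rule (X : finType) (S : X * X -> X * X)
    (k : crossing_type) (p : X * X) : X * X :=
  match k with
  | Positive => S p
  | Negative => finv S p
  | Virtual => (p.2, p.1)
  end.

(* Main.v *)
(** A coloring [c] by [(X, f, R)] turns into a coloring by [(X, VR)] when the label of
   each semiarc [a] is replaced by its image under the [g a]-th power of [f], provided [g] is an
   Alexander numbering: crossing the other strand from left to right raises [g] by one,
   and crossing it from right to left lowers [g] by one.  Following the knot, such a [g]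
   exists as soon as the signs of the crossings met along the loop between the two visits to a
   double point add up to zero.  Self-crossings of the loop contribute nothing, so this is
   the vanishing of the intersection number of two loops [gamma [s, t]] and
   [gamma [t, s']] in the plane (a sphere is first projected stereographically from a
   point missed by the curve).  That number is the winding number of
   [(u, v) |-> gamma u - gamma v] along the boundary of the rectangle
   [[s, t] x [t, s']], and opposite sides contribute opposite amounts. *)

Require Import Defs.
From mathcomp Require Import all_boot all_order all_algebra.
From mathcomp Require Import all_classical all_reals all_analysis.
From mathcomp Require Import ring lra zify.

Set Implicit Arguments.
Unset Strict Implicit.
Unset Printing Implicit Defensive.
Import Order.TTheory GRing.Theory Num.Theory.
Import numFieldNormedType.Exports.
Local Open Scope classical_set_scope.
Local Open Scope ring_scope.

(** * Crossings of a half-line *)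

(** Virtual crossings count in the numbering like classical ones, so only the immersed curve matters
    and planarity is enough. Self-crossings of a loop cancel because the two visits to a crossing
    carry opposite signs. The winding number is a signed count of crossings of segments with a
    half-line, without angles or homotopies. Such counts add up over the cells of a grid, and a cell
    whose four corners are sent into one open half-plane counts zero. Away from the intersections,
    the map thus only has to keep its nearby values in a common half-plane; it may be discontinuous.
    This freedom meets the main obstacle: [gamma u - gamma v] vanishes at the very intersections to
    be counted, and also at the corners of the rectangle. Around an intersection it is replaced by a
    map with four values, whose cell counts are exact wherever the grid lines fall; compactness then
    provides the mesh. *)

Section PlaneAlgebra.
Variable R : realType.
Implicit Types z w a b l : R * R.

Definition det2 z w : R := z.1 * w.2 - z.2 * w.1.
Definition dot2 l z : R := l.1 * z.1 + l.2 * z.2.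

Lemma det2C z w : det2 w z = - det2 z w.
Proof. by rewrite /det2; ring. Qed.

(** The segment meets the horizontal axis at abscissa [det2 z w / (w.2 - z.2)]; the last conjunct
    puts that point on the half-line. *)
Definition upcross z w : bool := [&& z.2 < 0, 0 <= w.2 & 0 < det2 z w].

(* Signed number of crossings of the segment from [z] to [w] with the half-line
   [{(x, 0) | x > 0}]; the points of height 0 count as lying above it. *)
Definition raycross z w : int := (upcross z w : nat)%:Z - (upcross w z : nat)%:Z.

Lemma raycrossC z w : raycross w z = - raycross z w.
Proof. by rewrite /raycross opprB. Qed.

(** By [l.1 * det2 z w = w.2 * dot2 l z - z.2 * dot2 l w], the sign of [det2 z w] is that of [l.1]
    as soon as [z] lies below the axis and [w] does not. *)
Lemma halfplane_upcross l z w : 0 < dot2 l z -> 0 < dot2 l w ->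
  upcross z w = [&& 0 < l.1, z.2 < 0 & 0 <= w.2].
Proof.
move=> lz lw; rewrite /upcross [RHS]andbC -andbA.
case: (ltP z.2 0) => //= z0; case: (leP 0 w.2) => //= w0.
have P : 0 < l.1 * det2 z w.
  have -> : l.1 * det2 z w = w.2 * dot2 l z + (- z.2) * dot2 l w.
    by rewrite /det2 /dot2; ring.
  by rewrite ltr_wpDl ?mulr_ge0 ?mulr_gt0 ?oppr_gt0 // ltW.
case: (ltP 0 l.1) => h; first by rewrite pmulr_rgt0 in P.
by apply/negbTE/negP => d; move: P; rewrite ltNge mulr_le0_ge0 // ltW.
Qed.

(** In an open half-plane the count is a coboundary, so it cancels around closed polygons. *)
Lemma halfplane_raycross l z w : 0 < dot2 l z -> 0 < dot2 l w ->
  raycross z w = ((0 < l.1) && (0 <= w.2) : nat)%:Z -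
                 ((0 < l.1) && (0 <= z.2) : nat)%:Z.
Proof.
move=> lz lw; rewrite /raycross !(halfplane_upcross lz lw, halfplane_upcross lw lz).
case: (ltP 0 l.1) => //= _; rewrite !ltNge.
by case: (0 <= z.2); case: (0 <= w.2).
Qed.

Definition cyclecross z1 z2 z3 z4 : int :=
  raycross z1 z2 + raycross z2 z3 + raycross z3 z4 + raycross z4 z1.

Lemma halfplane_cyclecross l z1 z2 z3 z4 :
  0 < dot2 l z1 -> 0 < dot2 l z2 -> 0 < dot2 l z3 -> 0 < dot2 l z4 ->
  cyclecross z1 z2 z3 z4 = 0.
Proof.
move=> h1 h2 h3 h4; rewrite /cyclecross.
rewrite (halfplane_raycross h1 h2) (halfplane_raycross h2 h3).
by rewrite (halfplane_raycross h3 h4) (halfplane_raycross h4 h1); ring.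
Qed.

(** The four consecutive determinants all equal [det2 c d], so the polygon makes one turn in the
    direction of that sign; only the heights of [c] and [d] remain to be distinguished. *)
Lemma parallelogram_cyclecross c d : det2 c d != 0 ->
  cyclecross c d (- c) (- d) = sgz (det2 c d).
Proof.
have e1 : det2 d (- c) = det2 c d by rewrite /det2 /=; ring.
have e2 : det2 (- c) (- d) = det2 c d by rewrite /det2 /=; ring.
have e3 : det2 (- d) c = det2 c d by rewrite /det2 /=; ring.
rewrite /cyclecross /raycross /upcross.
rewrite !(det2C c d, det2C d (- c), det2C (- c) (- d), det2C (- d) c) e1 e2 e3.
rewrite !oppr_gt0 /=.
have E : det2 c d = c.1 * d.2 - c.2 * d.1 by [].
rewrite !oppr_lt0 !oppr_ge0.
case: sgzP => [//|h _|h _]; rewrite ?andbT ?andbF /=.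
  case: (ltgtP c.2 0) => hc; case: (ltgtP d.2 0) => hd //=.
  by move: h; rewrite E hc hd !(mulr0, mul0r) subrr ltxx.
case: (ltgtP c.2 0) => hc; case: (ltgtP d.2 0) => hd //=.
by move: h; rewrite E hc hd !(mulr0, mul0r) subrr ltxx.
Qed.

End PlaneAlgebra.

(** * Local analysis at a double point *)

Section Grid.
Variables (R : realType) (G : R -> R -> R * R).

Definition cellcross u v u' v' :=
  cyclecross (G u v) (G u' v) (G u' v') (G u v').

(** Discrete Green formula: the two cells sharing an inner edge run through it in opposite
    directions. *)
Lemma sum_cellcross (x y : nat -> R) (m n : nat) :
  \sum_(0 <= i < m) \sum_(0 <= j < n) cellcross (x i) (y j) (x i.+1) (y j.+1) =
  \sum_(0 <= i < m)
     (raycross (G (x i) (y 0%N)) (G (x i.+1) (y 0%N)) -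
      raycross (G (x i) (y n)) (G (x i.+1) (y n))) +
  \sum_(0 <= j < n)
     (raycross (G (x m) (y j)) (G (x m) (y j.+1)) -
      raycross (G (x 0%N) (y j)) (G (x 0%N) (y j.+1))).
Proof.
pose H i j := raycross (G (x i) (y j)) (G (x i.+1) (y j)).
pose V i j := raycross (G (x i) (y j)) (G (x i) (y j.+1)).
have cellE i j : cellcross (x i) (y j) (x i.+1) (y j.+1) =
    (H i j - H i j.+1) + (V i.+1 j - V i j).
  rewrite /cellcross /cyclecross (raycrossC (G (x i) (y j.+1)) (G (x i.+1) _)).
  rewrite (raycrossC (G (x i) (y j)) (G (x i) (y j.+1))) -/(V i j) -/(H i j).
  by rewrite -/(V i.+1 j) -/(H i j.+1); lia.
under eq_bigr do under eq_bigr do rewrite cellE.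
under eq_bigr do rewrite big_split /=.
rewrite big_split /=; congr (_ + _).
  apply: eq_bigr => i _; rewrite -[RHS]opprB -(telescope_sumr (H i)) // -sumrN.
  by apply: eq_bigr => j _; rewrite opprB.
rewrite exchange_big; apply: eq_bigr => j _.
by rewrite (telescope_sumr (V ^~ j)).
Qed.

(** Half-open intervals make a point on a grid line belong to exactly one cell; the indicators
    telescope. *)
Lemma sum_half_open (x : nat -> R) (c : R) (m : nat) :
  nondecreasing_seq x -> x 0%N < c <= x m ->
  \sum_(0 <= i < m) ((x i < c <= x i.+1)%R : nat)%:Z = 1.
Proof.
move=> xn /andP[x0 xm].
transitivity (\sum_(0 <= i < m) (((c <= x i.+1)%R : nat)%:Z - ((c <= x i)%R : nat)%:Z)).
  apply: eq_bigr => i _; case: (ltP (x i) c) => //= [_|ci]; first by rewrite subr0.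
  by rewrite (le_trans ci) // xn.
by rewrite (telescope_sumr (fun i => ((c <= x i)%R : nat)%:Z)) // xm leNgt x0.
Qed.

End Grid.

Section LocalIntersection.
Variable R : realType.
Implicit Types (a b l : R * R) (p q : R).

(** Differentiability tested against each linear functional, the form in which half-plane arguments
    use it. *)
Definition has_tangent (gamma : R -> R * R) t a :=
  forall l e, 0 < e ->
    \forall u \near t,
      `|dot2 l (gamma u - gamma t) - (u - t) * dot2 l a| <= e * `|u - t|.

(** Zero counts as positive, in agreement with the cell intervals [u < u0 <= u1]. *)
Definition signed_by p a := if 0 <= p then a else - a.

(** At an intersection [gamma u - gamma v] has linear part [p a - q b]; keeping only the signs of
    [p] and [q] leaves the vertices of a parallelogram and removes the zero. *)
Definition corner_value a b p q : R * R := signed_by p a - signed_by q b.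

(** With [dual2], the dual basis of [(a, b)] for [dot2]. *)
Definition dual1 a b : R * R := (b.2 / det2 a b, - b.1 / det2 a b).
Definition dual2 a b : R * R := (- a.2 / det2 a b, a.1 / det2 a b).

Lemma dot2B l z w : dot2 l (z - w) = dot2 l z - dot2 l w.
Proof. by rewrite /dot2 /=; ring. Qed.

Lemma dot2N l z : dot2 l (- z) = - dot2 l z.
Proof. by rewrite /dot2 /=; ring. Qed.

Lemma dot2_signed l p a : dot2 l (signed_by p a) = (if 0 <= p then 1 else -1) * dot2 l a.
Proof. by rewrite /signed_by; case: ifP; rewrite ?dot2N ?mul1r // mulN1r. Qed.

Lemma dot2_dual c d a b : det2 a b != 0 ->
  let l := (c * (dual1 a b).1 + d * (dual2 a b).1,
            c * (dual1 a b).2 + d * (dual2 a b).2) in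
  dot2 l a = c /\ dot2 l b = d.
Proof.
rewrite /dot2 /= /det2 => h; split; field; exact: h.
Qed.

Lemma exists_functional c d a b : det2 a b != 0 ->
  exists l, dot2 l a = c /\ dot2 l b = d.
Proof. by move=> h; eexists; exact: (dot2_dual c d h). Qed.

(** A cell on one side of [u0] or of [v0] takes its values in a half-plane. Any other cell runs once
    through [b - a], [a + b], [a - b], [- a - b]. The minus sign is that of the determinant of
    [(p, q) |-> p a - q b]. *)
Lemma corner_cyclecross a b u u0 v v0 u1 v1 : det2 a b != 0 -> u <= u1 -> v <= v1 ->
  cyclecross (corner_value a b (u - u0) (v - v0)) (corner_value a b (u1 - u0) (v - v0))
    (corner_value a b (u1 - u0) (v1 - v0)) (corner_value a b (u - u0) (v1 - v0)) =
  - (sgz (det2 a b) * ((u < u0 <= u1) && (v < v0 <= v1) : nat)%:Z).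
Proof.
move=> ab uu vv.
have [su|su] := boolP (u < u0 <= u1); last first.
  have eu : (0 <= u1 - u0) = (0 <= u - u0).
    move: su; rewrite !subr_ge0; case: (leP u0 u) => h /=; last by move/negbTE.
    by rewrite (le_trans h uu).
  pose c : R := if 0 <= u - u0 then 1 else -1.
  have [l [la lb]] := exists_functional c 0 ab.
  rewrite /= mulr0 oppr0.
  have c2 : 0 < c * c by rewrite /c; case: ifP => _; lra.
  by apply: (@halfplane_cyclecross _ l);
    rewrite /corner_value dot2B !dot2_signed la lb mulr0 subr0 ?eu -/c.
have [sv|sv] := boolP (v < v0 <= v1); last first.
  have ev : (0 <= v1 - v0) = (0 <= v - v0).
    move: sv; rewrite !subr_ge0; case: (leP v0 v) => h /=; last by move/negbTE.
    by rewrite (le_trans h vv).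
  pose c : R := if 0 <= v - v0 then 1 else -1.
  have [l [la lb]] := exists_functional 0 (- c) ab.
  rewrite /= mulr0 oppr0.
  have c2 : 0 < c * c by rewrite /c; case: ifP => _; lra.
  by apply: (@halfplane_cyclecross _ l);
    rewrite /corner_value dot2B !dot2_signed la lb mulr0 sub0r ?ev -/c mulrN opprK.
rewrite /corner_value /signed_by !subr_ge0.
case/andP: su => su su1; case/andP: sv => sv sv1.
rewrite su1 sv1 !leNgt su sv /= mulr1.
pose c := b - a; pose d := a + b.
have e1 : - a - - b = c by rewrite /c opprK addrC.
have e2 : a - - b = d by rewrite opprK.
have e3 : a - b = - c by rewrite /c opprB.
have e4 : - a - b = - d by rewrite /d opprD.
have D : det2 c d = - 2 * det2 a b by rewrite /det2 /=; ring.
rewrite e1 e2 e3 e4 parallelogram_cyclecross D ?mulf_neq0 ?oppr_eq0 ?pnatr_eq0 //.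
by rewrite sgzM sgzN gtr0_sgz // mulN1r.
Qed.

Lemma near_fst (u v : R) (Q : R -> Prop) :
  (\forall x \near u, Q x) -> \forall x \near (u, v), Q x.1.
Proof. by move=> hQ; apply: (@cvg_fst _ _ (nbhs u) (nbhs v)). Qed.

Lemma near_snd (u v : R) (Q : R -> Prop) :
  (\forall x \near v, Q x) -> \forall x \near (u, v), Q x.2.
Proof. by move=> hQ; apply: (@cvg_snd _ _ (nbhs u) (nbhs v)). Qed.

(** One functional is positive on the true difference and on its replacement, so passing from one to
    the other stays within a half-plane. On the linear part it equals [|u - u0| + |v - v0|], which
    dominates the errors. *)
Lemma crossing_halfplane (gamma : R -> R * R) u0 v0 a b :
  gamma u0 = gamma v0 -> has_tangent gamma u0 a -> has_tangent gamma v0 b ->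
  det2 a b != 0 ->
  \forall r \near 0^'+, forall u v, `|u - u0| < r -> `|v - v0| < r ->
    (u, v) != (u0, v0) -> exists l, 0 < dot2 l (gamma u - gamma v) /\
      \forall x \near (u, v), 0 < dot2 l (corner_value a b (x.1 - u0) (x.2 - v0)).
Proof.
move=> uv ta tb ab.
pose al := dual1 a b; pose be := dual2 a b.
have [laa lab] : dot2 al a = 1 /\ dot2 al b = 0.
  by rewrite /al /dot2 /= /det2; split; field; exact: ab.
have [lba lbb] : dot2 be a = 0 /\ dot2 be b = 1.
  by rewrite /be /dot2 /= /det2; split; field; exact: ab.
(* With this constant the four error terms consume at most a quarter of the linear part. *)
have e8 : 0 < 8^-1 :> R by rewrite invr_gt0.
have /nbhs_ballP[r1 /= r1p h1] : \forall u \near u0,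
    `|dot2 al (gamma u - gamma u0) - (u - u0)| <= 8^-1 * `|u - u0| /\
    `|dot2 be (gamma u - gamma u0)| <= 8^-1 * `|u - u0|.
  near=> u; split.
    have : `|dot2 al (gamma u - gamma u0) - (u - u0) * dot2 al a| <= 8^-1 * `|u - u0|.
      by near: u; exact: ta.
    by rewrite laa mulr1.
  have : `|dot2 be (gamma u - gamma u0) - (u - u0) * dot2 be a| <= 8^-1 * `|u - u0|.
    by near: u; exact: ta.
  by rewrite lba mulr0 subr0.
have /nbhs_ballP[r2 /= r2p h2] : \forall u \near v0,
    `|dot2 al (gamma u - gamma v0)| <= 8^-1 * `|u - v0| /\
    `|dot2 be (gamma u - gamma v0) - (u - v0)| <= 8^-1 * `|u - v0|.
  near=> u; split.
    have : `|dot2 al (gamma u - gamma v0) - (u - v0) * dot2 al b| <= 8^-1 * `|u - v0|.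
      by near: u; exact: tb.
    by rewrite lab mulr0 subr0.
  have : `|dot2 be (gamma u - gamma v0) - (u - v0) * dot2 be b| <= 8^-1 * `|u - v0|.
    by near: u; exact: tb.
  by rewrite lbb mulr1.
near=> r => u v ur vr uvne.
have [A1 A2] : `|dot2 al (gamma u - gamma u0) - (u - u0)| <= 8^-1 * `|u - u0| /\
    `|dot2 be (gamma u - gamma u0)| <= 8^-1 * `|u - u0|.
  apply: h1; rewrite /ball /= distrC; apply: lt_le_trans ur _; near: r.
  exact: nbhs_right_le.
have [B1 B2] : `|dot2 al (gamma v - gamma v0)| <= 8^-1 * `|v - v0| /\
    `|dot2 be (gamma v - gamma v0) - (v - v0)| <= 8^-1 * `|v - v0|.
  apply: h2; rewrite /ball /= distrC; apply: lt_le_trans vr _; near: r.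
  exact: nbhs_right_le.
(* Since [Num.sg 0 = 0], on an axis the functional kills the vector whose sign jumps across that
   axis. *)
have [l [la lb]] := exists_functional (Num.sg (u - u0)) (- Num.sg (v - v0)) ab.
have lE z : dot2 l z = Num.sg (u - u0) * dot2 al z - Num.sg (v - v0) * dot2 be z.
  rewrite -la -[Num.sg (v - v0)]opprK -lb /al /be /dual1 /dual2 /dot2 /=.
  by rewrite /det2; field; exact: ab.
exists l; split.
  rewrite lE.
  have -> : gamma u - gamma v = (gamma u - gamma u0) - (gamma v - gamma v0).
    by rewrite uv opprB addrA subrK.
  rewrite !(dot2B _ (gamma u - _)).
  set X1 := dot2 al (gamma u - _) in A1 *; set X2 := dot2 be (gamma u - _) in A2 *.
  set Y1 := dot2 al (gamma v - _) in B1 *; set Y2 := dot2 be (gamma v - _) in B2 *.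
  have pq : u - u0 != 0 \/ v - v0 != 0.
    by move: uvne; rewrite xpair_eqE negb_and => /orP[] h; [left|right]; rewrite subr_eq0.
  move: (u - u0) (v - v0) pq A1 A2 B1 B2 => p q pq.
  rewrite !ler_norml.
  case: (sgrP p) => hp; case: (sgrP q) => hq; case: pq => //;
    rewrite ?hp ?hq ?eqxx ?normr0 //; move=> *; lra.
have sgnear (w w0 : R) : \forall x \near w,
    0 <= (if 0 <= x - w0 then 1 else -1) * Num.sg (w - w0) /\
    (w != w0 -> 0 < (if 0 <= x - w0 then 1 else -1) * Num.sg (w - w0)).
  case: (ltgtP w w0) => h.
  - near=> x; have xw : x < w0 by near: x; exact: lt_nbhsl.
    by rewrite ltr0_sg ?subr_lt0 // [0 <= x - w0]leNgt subr_lt0 xw /= mulrNN mulr1.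
  - near=> x; have xw : w0 < x by near: x; exact: lt_nbhsr.
    by rewrite gtr0_sg ?subr_gt0 // subr_ge0 (ltW xw) mulr1.
  - near=> x; rewrite h subrr sgr0 mulr0 lexx; split=> //; by rewrite eqxx.
have N1 := near_fst v (sgnear u u0); have N2 := near_snd u (sgnear v v0).
near=> x.
rewrite /corner_value dot2B !dot2_signed la lb mulrN opprK.
have [C1 C2] : 0 <= (if 0 <= x.1 - u0 then 1 else -1) * Num.sg (u - u0) /\
    (u != u0 -> 0 < (if 0 <= x.1 - u0 then 1 else -1) * Num.sg (u - u0)).
  by near: x.
have [D1 D2] : 0 <= (if 0 <= x.2 - v0 then 1 else -1) * Num.sg (v - v0) /\
    (v != v0 -> 0 < (if 0 <= x.2 - v0 then 1 else -1) * Num.sg (v - v0)).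
  by near: x.
move: uvne; rewrite xpair_eqE negb_and => /orP[] h.
  by rewrite ltr_wpDr // C2.
by rewrite ltr_wpDl // D2.
Unshelve. all: by end_near.
Qed.

End LocalIntersection.

(** * Intersection number of two loops *)

Section Subdivision.
Variable R : realType.

Lemma uniform_subdivision (s t d : R) : s < t -> 0 < d ->
  exists (m : nat) (x : nat -> R), [/\ x 0%N = s, x m = t,
    forall i, x i < x i.+1 <= x i + d &
    forall i, (i <= m)%N -> s <= x i <= t].
Proof.
move=> st d0; pose m := (Num.truncn ((t - s) / d)).+1.
have m0 : 0 < m%:R :> R by rewrite ltr0n.
pose h := (t - s) / m%:R.
have h0 : 0 < h by rewrite divr_gt0 // subr_gt0.
have hm : h * m%:R = t - s by rewrite divfK // gt_eqF.
have hd : h <= d.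
  rewrite ler_pdivrMr // -ler_pdivrMl // mulrC ltW //.
  by rewrite /m truncnS_gt.
exists m, (fun i => s + h * i%:R); split.
- by rewrite mulr0 addr0.
- by rewrite hm addrC subrK.
- by move=> i; rewrite -natr1 mulrDr mulr1 addrA ltrDl lerD2l h0.
- move=> i im; rewrite lerDl mulr_ge0 ?(ltW h0) //=.
  by rewrite -lerBrDl -hm ler_wpM2l ?ler_nat // ltW.
Qed.

Variables (G : R -> R -> R * R) (s t t' s' : R).
Variables (I : finType) (P : pred I) (c : I -> int) (U V : I -> R).
Hypotheses (st : s < t) (ts : t' < s').
Hypothesis zero_in : forall z, P z -> s < U z < t /\ t' < V z < s'.
Hypothesis G_left : forall v, t' <= v <= s' -> G s v = G t v.
Hypothesis G_bottom : forall u, s <= u <= t -> G u t' = G u s'.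

Let cell_claim u v u1 v1 := cellcross G u v u1 v1 =
  - \sum_(z | P z) c z * ((u < U z <= u1) && (v < V z <= v1) : nat)%:Z.

Hypothesis cell_local : forall u0 v0, s <= u0 <= t -> t' <= v0 <= s' ->
  exists2 e, 0 < e & forall u v u1 v1,
    [/\ `|u - u0| < e, `|v - v0| < e, `|u1 - u0| < e & `|v1 - v0| < e] ->
    u < u1 -> v < v1 ->
    s <= u -> u1 <= t -> t' <= v -> v1 <= s' -> cell_claim u v u1 v1.

(** The cell counts of a fine grid are summed in two ways: cell by cell, where each [z] is caught
    once, and along the boundary, where opposite sides cancel. *)
Lemma total_crossing0 : \sum_(z | P z) c z = 0.
Proof.
have cK : compact (`[s, t] `*` `[t', s'] : set (R * R)).
  by apply: compact_setX; exact: segment_compact.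
move/compact_near_coveringP/near_covering_withinP in cK.
have {cK} := cK R 0^'+ (fun d x => forall u1 v1, u1 <= t -> v1 <= s' ->
    x.1 < u1 <= x.1 + d -> x.2 < v1 <= x.2 + d -> cell_claim x.1 x.2 u1 v1) _ _.
case.
  move=> [u0 v0] [/= ]; rewrite !in_itv /= => hu hv.
  have [e e0 he] := cell_local hu hv.
  (* Half of [e] for the lower left corner and half for the side lengths keep the whole cell within
     [e]. *)
  exists (ball (u0, v0) (e / 2), [set d : R | 0 < d < e / 2]).
    split=> /=; first by apply: nbhsx_ballx; rewrite divr_gt0.
    near=> d; apply/andP; split; near: d; first exact: nbhs_right_gt.
    by apply: nbhs_right_lt; rewrite divr_gt0.
  move=> [[u v] d] /= [[/= bu bv] /andP[d0 d1]] [/=].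
  rewrite !in_itv /= => /andP[su ut] /andP[tv vs] u1 v1 u1t v1s /andP[uu1 u1d] /andP[vv1 v1d].
  apply: he => //.
  rewrite /ball /= in bu bv.
  rewrite !ltr_norml in bu bv *; case/andP: bu => bu1 bu2; case/andP: bv => bv1 bv2.
  by split; apply/andP; split; lra.
move=> d0 d0p hd.
have /hd {}hd : ball 0 d0 (d0 / 2).
  have d2 : d0 / 2 < d0 by rewrite ltr_pdivrMr // ltr_pMr // ltr1n.
  by rewrite /ball /= sub0r normrN gtr0_norm ?divr_gt0.
have d1 : 0 < d0 / 2 by rewrite divr_gt0.
have {}hd := hd d1.
have [m [x [x0 xm xd xi]]] := uniform_subdivision st d1.
have [n [y [y0 yn yd yi]]] := uniform_subdivision ts d1.
have xmono : nondecreasing_seq x.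
  by apply/nondecreasing_seqP => i; case/andP: (xd i) => /ltW.
have ymono : nondecreasing_seq y.
  by apply/nondecreasing_seqP => i; case/andP: (yd i) => /ltW.
pose Ix i z := ((x i < U z <= x i.+1)%R : nat)%:Z.
pose Iy j z := ((y j < V z <= y j.+1)%R : nat)%:Z.
have S1 : \sum_(0 <= i < m) \sum_(0 <= j < n) cellcross G (x i) (y j) (x i.+1) (y j.+1)
    = - \sum_(z | P z) c z.
  transitivity (\sum_(0 <= i < m) \sum_(0 <= j < n) - \sum_(z | P z) c z * (Ix i z * Iy j z)).
    apply: eq_big_nat => i /andP[_ im]; apply: eq_big_nat => j /andP[_ jn].
    have := hd (x i, y j); rewrite /= !in_itv /= => ->.
    - by congr (- _); apply: eq_bigr => z _; rewrite -PoszM mulnb.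
    - by rewrite xi ?yi // ltnW.
    - by case/andP: (xi i.+1 im).
    - by case/andP: (yi j.+1 jn).
    - exact: xd.
    - exact: yd.
  under eq_bigr do rewrite sumrN; rewrite sumrN; congr (- _).
  under eq_bigr do rewrite exchange_big /=.
  rewrite exchange_big /=; apply: eq_bigr => z Pz.
  have [hU hV] := zero_in Pz.
  under eq_bigr do rewrite -mulr_sumr -mulr_sumr.
  rewrite -mulr_sumr -mulr_suml !sum_half_open ?mulr1 //.
    by rewrite y0 yn; case/andP: hV => -> /ltW ->.
  by rewrite x0 xm; case/andP: hU => -> /ltW ->.
have S0 : \sum_(0 <= i < m) \sum_(0 <= j < n) cellcross G (x i) (y j) (x i.+1) (y j.+1) = 0.
  rewrite sum_cellcross y0 yn x0 xm [X in X + _]big_nat [X in _ + X]big_nat !big1 //.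
    by move=> j /andP[_ jn]; rewrite !G_left ?subrr ?yi // ltnW.
  by move=> i /andP[_ im]; rewrite !G_bottom ?subrr ?xi // ltnW.
by apply/eqP; rewrite -oppr_eq0 -S1 S0.
Unshelve. all: by end_near.
Qed.

End Subdivision.

Section TwoLoops.
Variables (R : realType) (gamma : R -> R * R) (s t s' : R) (a b : R * R).
Variables (I : finType) (P : pred I) (U V : I -> R) (A B : I -> R * R).
Hypotheses (st : s < t) (ts : t < s').
Hypotheses (gst : gamma s = gamma t) (gst' : gamma s' = gamma t).
Hypotheses (tan_s : has_tangent gamma s a) (tan_t : has_tangent gamma t b)
  (tan_s' : has_tangent gamma s' a) (ab : det2 a b != 0).
Hypothesis gamma_cont : forall l, continuous (fun u => dot2 l (gamma u)).
Hypothesis meet_in : forall z, P z -> s < U z < t /\ t < V z < s'.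
Hypothesis meet_eq : forall z, P z -> gamma (U z) = gamma (V z).
Hypothesis tan_U : forall z, P z -> has_tangent gamma (U z) (A z).
Hypothesis tan_V : forall z, P z -> has_tangent gamma (V z) (B z).
Hypothesis AB : forall z, P z -> det2 (A z) (B z) != 0.
Hypothesis meet_inj : forall z z', P z -> P z' -> U z = U z' -> V z = V z' -> z = z'.
Hypothesis meet_all : forall u v, s <= u <= t -> t <= v <= s' ->
  gamma u = gamma v -> (u \in [:: s; t] /\ v \in [:: t; s']) \/
    exists2 z, P z & u = U z /\ v = V z.

Definition near_meet r z u v := [&& P z, `|u - U z| < r & `|v - V z| < r].

(* The map [(u, v) |-> gamma u - gamma v] made nonvanishing: near an interior
   zero it is replaced by the signs of its linear part, and at the four corners
   of the rectangle, where it also vanishes, by [a - b]. *)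
Definition G r u v : R * R :=
  if [pick z | near_meet r z u v] is Some z
  then corner_value (A z) (B z) (u - U z) (v - V z)
  else if gamma u - gamma v == 0 then a - b else gamma u - gamma v.

Definition good_radius r := forall z, P z ->
  [/\ s + r < U z < t - r, t + r < V z < s' - r,
    forall z', P z' -> z != z' -> (r <= `|U z - U z'|) || (r <= `|V z - V z'|) &
    forall u v, `|u - U z| < r -> `|v - V z| < r -> (u, v) != (U z, V z) ->
      exists l, 0 < dot2 l (gamma u - gamma v) /\
        \forall x \near (u, v), 0 < dot2 l (corner_value (A z) (B z) (x.1 - U z) (x.2 - V z))].

Lemma exists_good_radius : exists2 r, 0 < r & good_radius r.
Proof.
suff : \forall r \near 0^'+, good_radius r.
  move=> h; near (0 : R)^'+ => r; exists r; first by near: r; exact: nbhs_right_gt.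
  by near: r.
apply: filter_forall => z.
have [Pz|/negP nPz] := boolP (P z); last by near=> r => Pz; case: nPz.
have [/andP[h1 h2] /andP[h3 h4]] := meet_in Pz.
have N1 : \forall r \near 0^'+, forall z', P z' -> z != z' ->
    (r <= `|U z - U z'|) || (r <= `|V z - V z'|).
  apply: filter_forall => z'.
  have [Pz'|/negP nPz'] := boolP (P z'); last by near=> r => Pz'; case: nPz'.
  have [->|zz] := eqVneq z z'; first by near=> r.
  have [UU|UU] := eqVneq (U z) (U z'); last first.
    near=> r => _ _; apply/orP; left; near: r; apply: nbhs_right_le.
    by rewrite normr_gt0 subr_eq0.
  have [VV|VV] := eqVneq (V z) (V z'); last first.
    near=> r => _ _; apply/orP; right; near: r; apply: nbhs_right_le.
    by rewrite normr_gt0 subr_eq0.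
  by rewrite (meet_inj Pz Pz' UU VV) eqxx in zz.
have N2 := crossing_halfplane (meet_eq Pz) (tan_U Pz) (tan_V Pz) (AB Pz).
near=> r => _; split.
- apply/andP; split.
    have : r < U z - s by near: r; apply: nbhs_right_lt; rewrite subr_gt0.
    by lra.
  have : r < t - U z by near: r; apply: nbhs_right_lt; rewrite subr_gt0.
  by lra.
- apply/andP; split.
    have : r < V z - t by near: r; apply: nbhs_right_lt; rewrite subr_gt0.
    by lra.
  have : r < s' - V z by near: r; apply: nbhs_right_lt; rewrite subr_gt0.
  by lra.
- by near: r.
- by near: r.
Unshelve. all: by end_near.
Qed.

Lemma dot2_sub_cont l : continuous (fun x : R * R => dot2 l (gamma x.1 - gamma x.2)).
Proof.
move=> w; rewrite (_ : (fun _ => _) =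
  (fun x : R * R => dot2 l (gamma x.1) - dot2 l (gamma x.2))); last first.
  by apply/funext => x; rewrite dot2B.
apply: cvgB.
  by apply: (@continuous_comp _ _ _ fst (fun u => dot2 l (gamma u))); [exact: cvg_fst|exact: gamma_cont].
by apply: (@continuous_comp _ _ _ snd (fun u => dot2 l (gamma u))); [exact: cvg_snd|exact: gamma_cont].
Qed.

Lemma tangent_sign t0 c l k : has_tangent gamma t0 c -> dot2 l c = k -> k != 0 ->
  \forall u \near t0, u != t0 -> 0 < dot2 l (gamma u - gamma t0) * ((u - t0) * k).
Proof.
move=> tc lc k0; have e0 : 0 < `|k| / 2 by rewrite divr_gt0 // normr_gt0.
near=> u => ut.
have : `|dot2 l (gamma u - gamma t0) - (u - t0) * dot2 l c| <= `|k| / 2 * `|u - t0|.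
  by near: u; exact: tc.
rewrite lc mulrAC -normrM [k * _]mulrC.
have : (u - t0) * k != 0 by rewrite mulf_neq0 // subr_eq0.
move: (dot2 l _) ((u - t0) * k) => X y y0.
case: (ltgtP y 0) y0 => // hy _; first by rewrite ltr0_norm // ler_norml nmulr_lgt0 //; lra.
by rewrite gtr0_norm // ler_norml pmulr_lgt0 //; lra.
Unshelve. all: by end_near.
Qed.

Section GoodRadius.
Variable r : R.
Hypotheses (r0 : 0 < r) (hr : good_radius r).

(** Replacement happens within [r / 4], and [r / 2 + r / 4] is below the separation [r]: a point
    within [r / 2] of an intersection can only receive the replacement of that intersection. *)
Lemma near_meet_unique z z' u v :
  near_meet (r / 2) z u v -> near_meet (r / 4) z' u v -> z = z'.
Proof.
case/and3P=> Pz h1 h2 /and3P[Pz' h3 h4]; have [//|zz] := eqVneq z z'.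
have [_ _ sep _] := hr Pz.
have hU : `|U z - U z'| <= `|u - U z| + `|u - U z'| by rewrite (distrC u); exact: ler_distD.
have hV : `|V z - V z'| <= `|v - V z| + `|v - V z'| by rewrite (distrC v); exact: ler_distD.
have rp := r0.
by case/orP: (sep z' Pz' zz) => h; exfalso; lra.
Qed.

Lemma near_meet_inside z u v : near_meet (r / 4) z u v ->
  [/\ s + r / 2 < u, u < t - r / 2, t + r / 2 < v & v < s' - r / 2].
Proof.
case/and3P=> Pz; rewrite !ltr_norml => /andP[h1 h2] /andP[h3 h4].
have [/andP[h5 h6] /andP[h7 h8] _ _] := hr Pz; have rp := r0.
by split; lra.
Qed.

Lemma near_ball2 (u0 v0 e : R) : 0 < e ->
  \forall x \near (u0, v0), `|x.1 - u0| < e /\ `|x.2 - v0| < e.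
Proof.
move=> e0; exists (ball u0 e, ball v0 e); first by split; exact: nbhsx_ballx.
by move=> [u v] [/= hu hv]; rewrite distrC; split=> //; rewrite distrC.
Qed.

Lemma G_near_zero z : P z -> \forall x \near (U z, V z),
  G (r / 4) x.1 x.2 = corner_value (A z) (B z) (x.1 - U z) (x.2 - V z).
Proof.
move=> Pz; have rp := r0; have r4 : 0 < r / 4 by rewrite divr_gt0.
apply: filterS (near_ball2 (U z) (V z) r4) => -[u v] /= [hu hv].
have zuv : near_meet (r / 4) z u v by apply/and3P.
rewrite /G; case: pickP => [z' z'uv|/(_ z)]; last by rewrite zuv.
suff -> : z' = z by [].
by apply: near_meet_unique zuv; case/and3P: z'uv => h1 h2 h3; apply/and3P; split => //; lra.
Qed.

(** Entering the rectangle from any of its corners, [gamma u - gamma v] is to first order a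
    combination of [a] and [- b] with nonnegative coefficients. A functional worth 1 on [a] and -1
    on [b] therefore suits all four corners, and also the value [a - b]. *)
Lemma G_corner u0 v0 : u0 \in [:: s; t] -> v0 \in [:: t; s'] ->
  exists l, \forall x \near (u0, v0), s <= x.1 <= t -> t <= x.2 <= s' ->
    0 < dot2 l (G (r / 4) x.1 x.2).
Proof.
move=> hu hv.
have [l [la lb]] := exists_functional 1 (-1) ab.
have n1 : -1 != 0 :> R by rewrite oppr_eq0 oner_eq0.
exists l.
have gu : gamma u0 = gamma t by move: hu; rewrite !inE => /orP[] /eqP ->.
have gv : gamma v0 = gamma t by move: hv; rewrite !inE => /orP[] /eqP ->.
have Nu : \forall u \near u0, s <= u <= t -> u != u0 -> 0 < dot2 l (gamma u - gamma t).
  move: hu; rewrite !inE => /orP[] /eqP -> {gu gv}.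
    rewrite -gst; apply: filterS (tangent_sign tan_s la (oner_neq0 _)) => u pos /andP[us _] ne.
    by have := pos ne; rewrite mulr1 pmulr_lgt0 // subr_gt0 lt_neqAle eq_sym ne.
  apply: filterS (tangent_sign tan_t lb n1) => u pos /andP[_ us] ne.
  by have := pos ne; rewrite pmulr_lgt0 // mulrN1 opprB subr_gt0 lt_neqAle ne.
have Nv : \forall v \near v0, t <= v <= s' -> v != v0 -> dot2 l (gamma v - gamma t) < 0.
  move: hv; rewrite !inE => /orP[] /eqP -> {gu gv}.
    apply: filterS (tangent_sign tan_t lb n1) => u pos /andP[us _] ne.
    by have := pos ne; rewrite nmulr_lgt0 // mulrN1 oppr_lt0 subr_gt0 lt_neqAle eq_sym ne.
  rewrite -gst'; apply: filterS (tangent_sign tan_s' la (oner_neq0 _)) => u pos /andP[_ us] ne.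
  by have := pos ne; rewrite mulr1 nmulr_lgt0 // subr_lt0 lt_neqAle ne.
have rp := r0; have r2 : 0 < r / 2 by rewrite divr_gt0.
have stp := st; have tsp := ts.
have N3 := near_ball2 u0 v0 r2.
have {}Nu := near_fst v0 Nu; have {}Nv := near_snd u0 Nv.
near=> x => xu xv.
have [b1 b2] : `|x.1 - u0| < r / 2 /\ `|x.2 - v0| < r / 2 by near: x.
have hxu : x.1 != u0 -> 0 < dot2 l (gamma x.1 - gamma t).
  by move: xu; near: x.
have hxv : x.2 != v0 -> dot2 l (gamma x.2 - gamma t) < 0.
  by move: xv; near: x.
rewrite /G; case: pickP => [z /near_meet_inside[h1 h2 h3 h4]|_].
  by move: hu b1; rewrite !inE ltr_norml => /orP[] /eqP -> /andP[]; lra.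
case: ifP => [_|/negbT ne]; first by rewrite dot2B la lb opprK.
have -> : gamma x.1 - gamma x.2 = (gamma x.1 - gamma t) - (gamma x.2 - gamma t).
  by rewrite opprB addrA subrK.
rewrite dot2B.
have dot20 : dot2 l (gamma t - gamma t) = 0 by rewrite subrr /dot2 /= !mulr0 addr0.
have [eu|/hxu {}hxu] := eqVneq x.1 u0.
  have [ev|/hxv {}hxv] := eqVneq x.2 v0.
    by rewrite eu ev gu gv subrr eqxx in ne.
  by rewrite eu gu dot20; lra.
have [ev|/hxv {}hxv] := eqVneq x.2 v0; last by lra.
by rewrite ev gv dot20; lra.
Unshelve. all: by end_near.
Qed.

Lemma dot2_self_gt0 w : w != 0 :> R * R -> 0 < dot2 w w.
Proof.
case: w => w1 w2; rewrite xpair_eqE negb_and /dot2 /= -!expr2 => /orP[] h.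
  by rewrite ltr_wpDr ?sqr_ge0 // exprn_even_gt0.
by rewrite ltr_wpDl ?sqr_ge0 // exprn_even_gt0.
Qed.

Lemma dot2_gt0_near l u v : 0 < dot2 l (gamma u - gamma v) ->
  \forall x \near (u, v), 0 < dot2 l (gamma x.1 - gamma x.2).
Proof.
by move=> h; exact: (cvgr_gt _ (@dot2_sub_cont l (u, v)) _ h).
Qed.

(** Near an intersection the functional of [good_radius] is positive on original and replaced values
    alike; far from intersections and corners, [gamma u0 - gamma v0] itself serves as the
    functional. *)
Lemma G_halfplane u0 v0 : s <= u0 <= t -> t <= v0 <= s' ->
  (forall z, P z -> (u0, v0) != (U z, V z)) ->
  exists l, \forall x \near (u0, v0), s <= x.1 <= t -> t <= x.2 <= s' ->
    0 < dot2 l (G (r / 4) x.1 x.2).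
Proof.
move=> hu hv nz.
have rp := r0; have r4 : 0 < r / 4 by rewrite divr_gt0.
case: (pselect (u0 \in [:: s; t] /\ v0 \in [:: t; s'])) => [[]|nc]; first exact: G_corner.
have [z zuv|nm] := pickP (fun z => near_meet (r / 2) z u0 v0).
  have /and3P[Pz h1 h2] := zuv.
  have [_ _ _ /(_ u0 v0)] := hr Pz.
  case; [lra|lra|exact: nz|move=> l [lF lC]]; exists l.
  have lF' := dot2_gt0_near lF.
  have d1 : 0 < r / 2 - `|u0 - U z| by rewrite subr_gt0.
  have d2 : 0 < r / 2 - `|v0 - V z| by rewrite subr_gt0.
  have N1 := near_ball2 u0 v0 d1; have N2 := near_ball2 u0 v0 d2.
  near=> x => _ _.
  have [b1 _] : `|x.1 - u0| < r / 2 - `|u0 - U z| /\ `|x.2 - v0| < r / 2 - `|u0 - U z|.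
    by near: x.
  have [_ b2] : `|x.1 - u0| < r / 2 - `|v0 - V z| /\ `|x.2 - v0| < r / 2 - `|v0 - V z|.
    by near: x.
  have zx : near_meet (r / 2) z x.1 x.2.
    have hU : `|x.1 - U z| <= `|x.1 - u0| + `|u0 - U z| by exact: ler_distD.
    have hV : `|x.2 - V z| <= `|x.2 - v0| + `|v0 - V z| by exact: ler_distD.
    by apply/and3P; split => //; lra.
  rewrite /G; case: pickP => [z' /(near_meet_unique zx) <-|_]; first by near: x.
  have pos : 0 < dot2 l (gamma x.1 - gamma x.2) by near: x.
  by case: ifP => // /eqP e; move: pos; rewrite e /dot2 /= !mulr0 addr0 ltxx.
have F0 : gamma u0 - gamma v0 != 0.
  rewrite subr_eq0; apply/eqP => /(meet_all hu hv) [//|[z Pz [e1 e2]]].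
  by have := nz z Pz; rewrite e1 e2 eqxx.
exists (gamma u0 - gamma v0).
have N1 := dot2_gt0_near (dot2_self_gt0 F0).
have N2 := near_ball2 u0 v0 r4.
near=> x => _ _.
have [b1 b2] : `|x.1 - u0| < r / 4 /\ `|x.2 - v0| < r / 4 by near: x.
rewrite /G; case: pickP => [z /and3P[Pz h1 h2]|_].
  have := nm z; rewrite /near_meet Pz /=.
  have hU : `|u0 - U z| <= `|x.1 - u0| + `|x.1 - U z| by rewrite (distrC x.1); exact: ler_distD.
  have hV : `|v0 - V z| <= `|x.2 - v0| + `|x.2 - V z| by rewrite (distrC x.2); exact: ler_distD.
  by case/negbT/nandP; rewrite -leNgt; lra.
have pos : 0 < dot2 (gamma u0 - gamma v0) (gamma x.1 - gamma x.2) by near: x.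
by case: ifP => // /eqP e; move: pos; rewrite e /dot2 /= !mulr0 addr0 ltxx.
Unshelve. all: by end_near.
Qed.

Lemma cell_sum_local u0 v0 : s <= u0 <= t -> t <= v0 <= s' ->
  exists2 e, 0 < e & forall u v u1 v1,
    [/\ `|u - u0| < e, `|v - v0| < e, `|u1 - u0| < e & `|v1 - v0| < e] ->
    u < u1 -> v < v1 ->
    s <= u -> u1 <= t -> t <= v -> v1 <= s' ->
    cellcross (G (r / 4)) u v u1 v1 =
    - \sum_(z | P z) sgz (det2 (A z) (B z)) *
        ((u < U z <= u1) && (v < V z <= v1) : nat)%:Z.
Proof.
move=> hu hv.
have ball_near (Q : R * R -> Prop) e : ball (u0, v0) e `<=` Q -> forall u v,
    `|u - u0| < e -> `|v - v0| < e -> Q (u, v).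
  move=> sub u v h1 h2; apply: sub; split; rewrite /ball /= distrC //.
case: (pselect (exists2 z, P z & u0 = U z /\ v0 = V z)) => [[z Pz [eu ev]]|nz].
  have /nbhs_ballP[e /= e0 he] := G_near_zero Pz; rewrite -eu -ev in he.
  (* [e] ensures that all four corners of the cell carry replaced values, [r] keeps the other
     intersections out. *)
  exists (Num.min e r) => [|u v u1 v1]; first by rewrite lt_min e0 r0.
  rewrite !lt_min => -[/andP[b1 c1] /andP[b2 c2] /andP[b3 c3] /andP[b4 c4]] uu vv _ _ _ _.
  rewrite (bigD1 z) //= big1 ?addr0 => [|z' /andP[Pz' zz]].
    have GE := ball_near _ _ he; rewrite /cellcross !GE //= eu ev.
    by rewrite corner_cyclecross ?(ltW uu) ?(ltW vv) //; exact: AB.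
  case: andP => [[/andP[h1 h2] /andP[h3 h4]]|_]; last by rewrite mulr0.
  have [_ _ sep _] := hr Pz; rewrite eq_sym in zz.
  exfalso; have {zz} := sep z' Pz' zz; rewrite -eu -ev.
  move: b1 b2 b3 b4 c1 c2 c3 c4; rewrite !ltr_norml => _ _ _ _.
  move=> /andP[c1 d1] /andP[c2 d2] /andP[c3 d3] /andP[c4 d4].
  rewrite leNgt [r <= `|v0 - _|]leNgt -negb_and => /negP; apply.
  by rewrite !ltr_norml; apply/andP; split; apply/andP; split; lra.
have [|l hl] := @G_halfplane u0 v0 hu hv.
  move=> z Pz; apply/eqP => -[eu ev]; apply: nz; exists z => //.
have /nbhs_ballP[e /= e0 he] := hl.
have : \forall d \near 0^'+, forall z, P z -> (d <= `|u0 - U z|) || (d <= `|v0 - V z|).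
  apply: filter_forall => z.
  have [Pz|/negP nPz] := boolP (P z); last by near=> d => Pz; case: nPz.
  have [UU|UU] := eqVneq u0 (U z); last first.
    near=> d => _; apply/orP; left; near: d; apply: nbhs_right_le.
    by rewrite normr_gt0 subr_eq0.
  have [VV|VV] := eqVneq v0 (V z); last first.
    near=> d => _; apply/orP; right; near: d; apply: nbhs_right_le.
    by rewrite normr_gt0 subr_eq0.
  by exfalso; apply: nz; exists z.
move=> hd; near (0 : R)^'+ => d.
have d0 : 0 < d by near: d; exact: nbhs_right_gt.
have sep : forall z, P z -> (d <= `|u0 - U z|) || (d <= `|v0 - V z|) by near: d.
exists (Num.min e d) => [|u v u1 v1]; first by rewrite lt_min e0 d0.
rewrite !lt_min => -[/andP[b1 c1] /andP[b2 c2] /andP[b3 c3] /andP[b4 c4]] uu vv su ut tv vs.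
rewrite big1 ?oppr0 => [|z Pz].
  have GE := ball_near _ _ he.
  have us : s <= u1 by rewrite (le_trans su) // ltW.
  have tu : u <= t by rewrite (le_trans _ ut) // ltW.
  have vt : t <= v1 by rewrite (le_trans tv) // ltW.
  have sv : v <= s' by rewrite (le_trans _ vs) // ltW.
  by rewrite /cellcross (@halfplane_cyclecross _ l) //; apply: GE => //=; apply/andP.
case: andP => [[/andP[h1 h2] /andP[h3 h4]]|_]; last by rewrite mulr0.
exfalso; have := sep z Pz.
move: b1 b2 b3 b4 c1 c2 c3 c4; rewrite !ltr_norml => _ _ _ _.
move=> /andP[c1 d1] /andP[c2 d2] /andP[c3 d3] /andP[c4 d4].
rewrite leNgt [d <= `|v0 - _|]leNgt -negb_and => /negP; apply.
by rewrite !ltr_norml; apply/andP; split; apply/andP; split; lra.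
Unshelve. all: by end_near.
Qed.

(** Replacements stay off the boundary, and there the equalities come from
    [gamma s = gamma t = gamma s']. *)
Lemma G_edges u v : s <= u <= t -> t <= v <= s' ->
  G (r / 4) s v = G (r / 4) t v /\ G (r / 4) u t = G (r / 4) u s'.
Proof.
move=> hu hv; have rp := r0; have stp := st; have tsp := ts.
have edge u1 v1 : [\/ u1 = s, u1 = t, v1 = t | v1 = s'] ->
    G (r / 4) u1 v1 = if gamma u1 - gamma v1 == 0 then a - b else gamma u1 - gamma v1.
  rewrite /G; case: pickP => // z /near_meet_inside[h1 h2 h3 h4].
  by case=> e; exfalso; lra.
rewrite !edge ?gst ?gst' //.
- by apply: Or44.
- by apply: Or43.
- by apply: Or42.
- by apply: Or41.
Qed.

End GoodRadius.

Theorem two_loops_intersection : \sum_(z | P z) sgz (det2 (A z) (B z)) = 0.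
Proof.
have [r r0 hr] := exists_good_radius.
have tt : s <= t <= t by rewrite lexx ltW.
have tt' : t <= t <= s' by rewrite lexx ltW.
apply: (total_crossing0 (G := G (r / 4)) st ts meet_in) => [v hv|u hu|u v hu hv].
- exact: (G_edges r0 hr tt hv).1.
- exact: (G_edges r0 hr hu tt').2.
- by have := cell_sum_local r0 hr hu hv.
Qed.

End TwoLoops.

(** * Recoloring and Alexander numberings *)

Section Recoloring.
Variables (X : finType) (f : X -> X) (S : X * X -> X * X).
Hypothesis hX : virtual_biquandle f S.

Let fI : injective f. Proof. by case: hX => _ /bij_inj. Qed.

(** At a crossing the two left semiarcs have number [m.+1] and the two right ones [m], so the same
    map acts on incoming and outgoing pairs. *)
Definition twist m (p : X * X) := (iter m.+1 f p.1, iter m f p.2).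

Lemma twist_inj m : injective (twist m).
Proof.
have fm k : injective (iter k f) by elim: k => //= k IH x y /fI /IH.
by move=> [x y] [x' y'] [/fI /fm /= -> /fm /= ->].
Qed.

Lemma iter_vbiq_morph m x y :
  (iter m f (S (x, y)).1, iter m f (S (x, y)).2) = S (iter m f x, iter m f y).
Proof.
elim: m => [|m IH] /=; first by case: (S _).
by case: hX => _ _ <-; rewrite -IH.
Qed.

(** The [f] and [f^{-1}] inside [VR] level the exponents: the first component evaluates [S] at two
    [m.+1]-st iterates, the second at two [m]-th iterates, and [f] commutes with [S]. *)
Lemma VR_twist m p : VR f S (twist m p) = twist m (S p).
Proof.
case: p => x y; rewrite /VR /twist [iter m.+1 f (x, y).1]/= (finv_f fI) /=.
by rewrite -(iter_vbiq_morph m.+1) -iter_vbiq_morph.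
Qed.

(** The negative case is the positive one inverted; at a virtual crossing [f^{-1}] and [f] make up
    for the exchange of exponents. *)
Lemma biquandle_rule_twist m k p :
  biquandle_rule (VR f S) k (twist m p) = twist m (virtual_biquandle_rule f S k p).
Proof.
have SI : injective S by case: hX => -[_ _ /bij_inj].
have VI : injective (VR f S) by case: (VR_biquandle hX) => _ _ /bij_inj.
case: k => /=; first exact: VR_twist.
  by apply: (VI); rewrite (f_finv VI) VR_twist (f_finv SI).
by rewrite /twist /= -!iterS !iterSr (f_finv fI).
Qed.

(** The relabeling is an injective self-map of a finite set, and injectivity of [twist] makes it
    both preserve and reflect the condition at each crossing. *)
Lemma num_colorings_VR (R : realType) (D : knot_diagram R) (g : semiarc D -> nat) :
  (forall i j, crossing i j -> [/\ g (in_arc j) = (g (in_arc i)).+1,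
     g (out_arc i) = g (in_arc j) & g (out_arc j) = g (in_arc i)]) ->
  num_colorings D (virtual_biquandle_rule f S) =
  num_colorings D (biquandle_rule (VR f S)).
Proof.
move=> hg.
have fm k : injective (iter k f) by elim: k => //= k IH x y /fI /IH.
pose phi (c : {ffun semiarc D -> X}) : {ffun semiarc D -> X} :=
  [ffun a => iter (g a) f (c a)].
have phiI : injective phi.
  by move=> c c' /ffunP h; apply/ffunP => a; have := h a; rewrite !ffunE => /fm.
have numE r : num_colorings D r = #|finset (@coloring R D X r)|.
  by apply: eq_card => c; rewrite [RHS]inE; apply/idP/idP; rewrite !in_setE.
rewrite !numE -[RHS](card_preimset _ phiI); apply: eq_card => c.
rewrite !inE; apply: eq_forallb => i; apply: eq_forallb => j.
case: (boolP (crossing i j)) => //= /hg [e1 e2 e3].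
rewrite !ffunE e2 e3 e1.
pose tw := twist (g (in_arc i)).
rewrite -[(iter _.+1 f _, iter _ f (c (out_arc j)))]/(tw (c (out_arc i), c (out_arc j))).
rewrite -[(iter _.+1 f _, _)]/(tw (c (in_arc j), c (in_arc i))).
by rewrite biquandle_rule_twist (inj_eq (@twist_inj _)).
Qed.

End Recoloring.

(** * An Alexander numbering from partial sums of signs *)

Section Numbering.
Variables (R : realType) (D : knot_diagram R).
Implicit Types i j k l : 'I_(nparam D).
Let n := nparam D.

Definition meets k l := (k != l) && (curve D (param k) == curve D (param l)).

Definition strand_sign k l : int :=
  sgz (orientation (surf D) (curve D (param k))
    (derive1 (curve D) (param k)) (derive1 (curve D) (param l))).

(** At most one term, since no point is triple; the sum spares a choice of the partner of [k]. *)
Definition crossing_sign k : int := \sum_(l | meets k l) strand_sign k l.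

Lemma meetsC k l : meets k l = meets l k.
Proof. by rewrite /meets eq_sym; congr (_ && _); rewrite eq_sym. Qed.

Lemma orientationE (F : surface) (p u v : 'rV[R]_3) :
  let n := normal F p in
  orientation F p u v = n 0 0 * (u 0 1 * v 0 (inord 2) - u 0 (inord 2) * v 0 1)
    + n 0 1 * (u 0 (inord 2) * v 0 0 - u 0 0 * v 0 (inord 2))
    + n 0 (inord 2) * (u 0 0 * v 0 1 - u 0 1 * v 0 0).
Proof.
(* Indexing entries by naturals identifies the various forms of one ordinal before [ring]. *)
have [W hW] : exists W : 'rV[R]_3 -> nat -> R, forall (w : 'rV_3) (k : 'I_3), w 0 k = W w k.
  by exists (fun w m => w 0 (inord m)) => w k; rewrite inord_val.
rewrite /orientation (expand_det_row _ ord0) !big_ord_recl big_ord0.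
rewrite /cofactor !(expand_det_row _ ord0) !big_ord_recl !big_ord0.
rewrite /cofactor !det_mx11 !mxE /= !hW /= !inordK // /bump /=.
by rewrite !(expr0, expr1, expr2, mul1r, addr0); ring.
Qed.

Lemma orientationC (F : surface) (p u v : 'rV[R]_3) :
  orientation F p v u = - orientation F p u v.
Proof. by rewrite !orientationE /=; ring. Qed.

Lemma strand_signC k l : meets k l -> strand_sign l k = - strand_sign k l.
Proof.
by case/andP=> _ /eqP e; rewrite /strand_sign e orientationC sgzN.
Qed.

Lemma meets_unique k l l' : meets k l -> meets k l' -> l = l'.
Proof.
move=> /andP[n1 /eqP e1] /andP[n2 /eqP e2].
by case: (no_triple_point (esym e1) e2) => // e; rewrite e eqxx in n1 n2.
Qed.

Lemma crossing_signE i j : meets i j -> crossing_sign i = strand_sign i j.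
Proof.
move=> ij; rewrite /crossing_sign (bigD1 j) //= big1 ?addr0 // => l /andP[il].
by rewrite (meets_unique il ij) eqxx.
Qed.

Lemma sum_sign_inner (A : pred 'I_n) :
  \sum_(k | A k) \sum_(l | meets k l && A l) strand_sign k l = 0.
Proof.
set s := LHS; have : s = - s.
  rewrite {1}/s (exchange_big_dep A) /=; last by move=> k l _ /andP[].
  rewrite -sumrN; apply: eq_bigr => k Ak; rewrite -sumrN.
  apply: congr_big => // [l|l /and3P[Al ml _]].
    by rewrite Ak andbT meetsC andbC.
  by rewrite strand_signC // meetsC.
by lia.
Qed.

Hypothesis arc_intersection : forall i j, (i < j)%N ->
  curve D (param i) = curve D (param j) ->
  \sum_(k : 'I_(nparam D) | (i < k < j)%N)
    \sum_(l : 'I_(nparam D) | meets k l && ~~ (i <= l <= j)%N) strand_sign k l = 0.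

(** Partners outside the arc contribute zero by [arc_intersection], those inside by antisymmetry;
    [i] and [j] are partners of each other, hence of no [k] strictly between. *)
Lemma sum_crossing_sign_arc i j : (i < j)%N ->
  curve D (param i) = curve D (param j) ->
  \sum_(k : 'I_(nparam D) | (i < k < j)%N) crossing_sign k = 0.
Proof.
move=> ij e.
have mij : meets i j by rewrite /meets e eqxx andbT neq_ltn ij.
rewrite -[RHS](addr0 0) -[in X in _ = X + _](arc_intersection ij e).
rewrite -[in X in _ = _ + X](sum_sign_inner (fun k : 'I_n => i < k < j)%N) -big_split /=.
apply: eq_bigr => k hk; rewrite /crossing_sign.
rewrite (bigID (fun l : 'I_n => ~~ (i <= l <= j)%N)) /=; congr (_ + _).
apply: eq_bigl => l; case: (boolP (meets k l)) => //= ml.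
rewrite negbK; apply/idP/idP=> hl; last by lia.
have li : l != i.
  apply/eqP => le; rewrite le meetsC in ml; by rewrite -(meets_unique mij ml) ltnn ?andbF in hk.
have lj : l != j.
  apply/eqP => le; rewrite le meetsC in ml; rewrite meetsC in mij.
  by rewrite -(meets_unique mij ml) ltnn ?andbF in hk.
case/andP: hl => il lj2; rewrite !ltn_neqAle il lj2 !andbT; apply/andP; split.
  by apply: contraNneq li => /val_inj ->.
by apply: contraNneq lj => /val_inj ->.
Qed.

(** Up to a constant, [partial_sign a.+1] is the number of the semiarc leaving index [a]. *)
Definition partial_sign (m : nat) : int := \sum_(k : 'I_(nparam D) | (k < m)%N) crossing_sign k.

Lemma partial_sign_full : partial_sign n = 0.
Proof.
rewrite /partial_sign (eq_bigl predT) => [|k]; last by rewrite ltn_ord.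
rewrite -[RHS](sum_sign_inner predT); apply: eq_bigr => k _.
by apply: eq_bigl => l; rewrite andbT.
Qed.

Lemma partial_signS k : partial_sign k.+1 = partial_sign k + crossing_sign k.
Proof.
rewrite /partial_sign (bigD1 k) //= addrC; congr (_ + _).
by apply: eq_bigl => l; rewrite ltnS -val_eqE ltn_neqAle andbC.
Qed.

(** At index 0 the incoming semiarc is the last one, so the vanishing of the full sum closes the
    numbering up. *)
Lemma partial_sign_pred k : partial_sign (ord_pred k).+1 = partial_sign k.
Proof.
case: k => [[|k] hk] /=.
  rewrite add0n modn_small ?ltn_predL // (prednK hk) partial_sign_full.
  by rewrite /partial_sign big1.
by rewrite addnC modnDl modn_small // ltnW.
Qed.

Lemma partial_sign_arc i j : (i < j)%N ->
  curve D (param i) = curve D (param j) ->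
  partial_sign j = partial_sign i.+1.
Proof.
move=> ij e; rewrite -[RHS]addr0 -(sum_crossing_sign_arc ij e).
rewrite /partial_sign (bigID (fun k : 'I__ => (k < i.+1)%N)) /=.
by congr (_ + _); apply: eq_bigl => k; lia.
Qed.

Lemma Alexander_numbering : exists g : semiarc D -> nat,
  forall i j, crossing i j -> [/\ g (in_arc j) = (g (in_arc i)).+1,
     g (out_arc i) = g (in_arc j) & g (out_arc j) = g (in_arc i)].
Proof.
(* A shift by [N] makes the numbers natural, as exponents of [f] must be. *)
pose N := \sum_(m < (maxn n 1).+1) absz (partial_sign m).
have hN (m : 'I_(maxn n 1)) : - N%:Z <= partial_sign m.+1.
  have : (absz (partial_sign m.+1) <= N)%N.
    have hm : (m.+1 < (maxn n 1).+1)%N by rewrite ltnS ltn_ord.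
    by rewrite /N (bigD1 (Ordinal hm)) //= leq_addr.
  by lia.
exists (fun a : 'I_(maxn n 1) => absz (partial_sign a.+1 + N%:Z)) => i j cij.
have [/andP[nij /eqP e] pos] : meets i j /\ 0 < orientation (surf D)
    (curve D (param i)) (derive1 (curve D) (param i)) (derive1 (curve D) (param j)).
  by case/and3P: cij => n1 e1 ->; rewrite /meets n1.
have mij : meets i j by rewrite /meets nij e eqxx.
have s1 : strand_sign i j = 1 by rewrite /strand_sign gtr0_sgz.
have si : crossing_sign i = 1 by rewrite (crossing_signE mij).
have sj : crossing_sign j = -1.
  by rewrite (@crossing_signE j i) 1?meetsC // (strand_signC mij) s1.
(* If [j] is visited first, the arc from [j] to [i] gives the same equation, the two signs being 1
   and -1. *)
have key : partial_sign j = partial_sign i.+1.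
  case: (ltngtP i j) => [ij|ji|/val_inj ij].
  - exact: partial_sign_arc.
  - have := partial_sign_arc ji (esym e); rewrite !partial_signS; lia.
  - by rewrite ij eqxx in nij.
have h1 := hN (in_arc i); have h2 := hN (in_arc j).
have h3 := hN (out_arc i); have h4 := hN (out_arc j).
rewrite /in_arc /out_arc /= in h1 h2 h3 h4 *.
rewrite !partial_sign_pred in h1 h2 *.
rewrite !partial_signS in key h3 h4 *.
by split; lia.
Qed.

End Numbering.

(** * Diagrams in a planar chart *)

Section Tangents.
Variable R : realType.

Lemma is_derive_approx (f : R -> R) (t d e : R) : is_derive t 1 f d -> 0 < e ->
  \forall u \near t, `|f u - f t - (u - t) * d| <= e * `|u - t|.
Proof.
move=> [df fd] e0.
have cv : h^-1 *: ((f \o shift t) (h *: 1) - f t) @[h --> 0^'] --> d.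
  by rewrite -fd; exact: df.
move/cvgrPdist_le : cv => /(_ _ e0) /= [r /= rp hr].
exists r => //= u ut; have [->|une] := eqVneq u t.
  by rewrite !subrr mul0r subr0 !normr0 mulr0.
have ut0 : u - t != 0 by rewrite subr_eq0.
have := hr (u - t) _ ut0; rewrite /ball_ /= sub0r normrN distrC => /(_ ut).
rewrite [(u - t) *: 1]mulr1 subrK => H.
have -> : f u - f t - (u - t) * d = ((u - t)^-1 * (f u - f t) - d) * (u - t).
  by field.
by rewrite normrM [`|t - u|]distrC ler_wpM2r // distrC.
Qed.

Lemma has_tangent_derive (x y : R -> R) (t dx dy : R) :
  is_derive t 1 x dx -> is_derive t 1 y dy ->
  has_tangent (fun u => (x u, y u)) t (dx, dy).
Proof.
move=> hx hy l e e0.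
pose f u := l.1 * x u + l.2 * y u.
have hf : is_derive t 1 f (l.1 * dx + l.2 * dy).
  exact: is_deriveD (is_deriveZ _ _) (is_deriveZ _ _).
apply: filterS (is_derive_approx hf e0) => u.
by rewrite -/(dot2 l (dx, dy)) dot2B.
Qed.

End Tangents.

Section Charts.
Variables (R : realType) (D : knot_diagram R).
Implicit Types i j k l : 'I_(nparam D).

Lemma param_lt i j : (param i < param j) = (i < j)%N.
Proof.
case: (ltngtP i j) => [/param_increasing -> //|/param_increasing h|/val_inj ->].
  by apply/negbTE; rewrite -leNgt ltW.
by rewrite ltxx.
Qed.

Lemma param_le i j : (param i <= param j) = (i <= j)%N.
Proof. by rewrite leNgt param_lt -leqNgt. Qed.

Lemma param_inj : injective (@param R D).
Proof.
move=> i j e; apply/val_inj/eqP; rewrite eqn_leq -!param_le e lexx //.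
Qed.

Lemma double_point u v : 0 <= u < 1 -> 0 <= v < 1 -> u != v ->
  curve D u = curve D v -> exists k, param k = u.
Proof.
by move=> hu hv uv e; apply/(param_double D hu); exists v; split=> //; rewrite eq_sym.
Qed.

Variables (gamma delta : R -> R * R) (kappa : int).
Hypotheses (k0 : kappa != 0)
  (gammaP : forall u v, gamma u = gamma v <-> curve D u = curve D v)
  (gamma_tan : forall u, has_tangent gamma u (delta u))
  (delta_periodic : forall u, delta (u + 1) = delta u)
  (gamma_cont : forall l : R * R, continuous (fun u => dot2 l (gamma u)))
  (det_delta : forall u v, curve D u = curve D v ->
    sgz (det2 (delta u) (delta v)) =
    kappa * sgz (orientation (surf D) (curve D u) (derive1 (curve D) u) (derive1 (curve D) v))).

(** A chart changes all signs by the common nonzero factor [kappa], so a vanishing sum in the chart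
    vanishes on the surface. *)
Lemma chart_arc_intersection i j : (i < j)%N ->
  curve D (param i) = curve D (param j) ->
  \sum_(k : 'I_(nparam D) | (i < k < j)%N)
    \sum_(l : 'I_(nparam D) | meets k l && ~~ (i <= l <= j)%N) strand_sign k l = 0.
Proof.
move=> ij eij.
have mij : meets i j by rewrite /meets eij eqxx andbT neq_ltn ij.
rewrite pair_big_dep /=.
set P := (X in \sum_(p | X p) _).
pose U (p : 'I_(nparam D) * 'I_(nparam D)) := param p.1.
(* The complementary arc wraps past 1; parameters before [i] are moved by one period to fit in
   [[param j, param i + 1]]. *)
pose V (p : 'I_(nparam D) * 'I_(nparam D)) :=
  if (p.2 < i)%N then param p.2 + 1 else param p.2.
have curveV p : curve D (V p) = curve D (param p.2).
  by rewrite /V; case: ifP => // _; rewrite curve_periodic.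
have deltaV p : delta (V p) = delta (param p.2).
  by rewrite /V; case: ifP => // _; rewrite delta_periodic.
have st : param i < param j by rewrite param_lt.
have /andP[i0 i1] := param_range i; have /andP[j0 j1] := param_range j.
have ts : param j < param i + 1 by lra.
have meet_det k l : meets k l -> det2 (delta (param k)) (delta (param l)) != 0.
  case/andP=> kl /eqP e; rewrite -sgz_eq0 det_delta // mulf_eq0 negb_or k0 /=.
  by rewrite sgz_eq0 transverse.
have sumE : \sum_(p | P p) sgz (det2 (delta (U p)) (delta (V p))) =
    kappa * \sum_(p | P p) strand_sign p.1 p.2.
  rewrite mulr_sumr; apply: eq_bigr => p /andP[_ /andP[/andP[_ /eqP e] _]].
  by rewrite deltaV det_delta.
suff : \sum_(p | P p) sgz (det2 (delta (U p)) (delta (V p))) = 0.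
  by rewrite sumE => /eqP; rewrite mulf_eq0 (negbTE k0) => /eqP.
have dij := meet_det _ _ mij.
have gij : gamma (param i) = gamma (param j) by apply/gammaP.
have gij' : gamma (param i + 1) = gamma (param j).
  by apply/gammaP; rewrite curve_periodic.
have tan' : has_tangent gamma (param i + 1) (delta (param i)).
  by rewrite -delta_periodic.
apply: (two_loops_intersection (P := P) (U := U) (V := V) (A := delta \o U) (B := delta \o V) st ts gij gij' (gamma_tan _) (gamma_tan _) tan' dij gamma_cont) => //.
- move=> [k l] /= /andP[/andP[ik kj] /andP[mkl il]]; split.
    by rewrite /U /= !param_lt ik.
  have /andP[l0 l1] := param_range l.
  rewrite /V /=; have [li|li] := ltnP l i.
    have h : param l < param i by rewrite param_lt.
    by apply/andP; split; lra.
  have jl : param j < param l by rewrite param_lt ltnNge; move: il; rewrite li.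
  by apply/andP; split; lra.
- move=> [k l] /= /andP[_ /andP[/andP[_ /eqP e] _]].
  by apply/gammaP; rewrite curveV.
- move=> [k l] /= /andP[_ /andP[mkl _]]; rewrite deltaV; exact: meet_det.
- move=> [k l] [k' l'] _ _; rewrite /U /V /= => /param_inj -> e; congr (_, _).
  apply: param_inj; have /andP[l0 l1] := param_range l.
  have /andP[l0' l1'] := param_range l'.
  by move: e; case: ifP => _; case: ifP => _ e; lra.
- move=> u v /andP[ui uj] /andP[vj vi] /gammaP euv.
  pose v0 := if v < 1 then v else v - 1.
  have cv : curve D v0 = curve D v.
    by rewrite /v0; case: ifP => // _; rewrite -[in RHS](subrK 1 v) curve_periodic.
  have v0r : 0 <= v0 < 1.
    by rewrite /v0; case: ltP => h; apply/andP; split; lra.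
  have ur : 0 <= u < 1 by apply/andP; split; lra.
  (* The two intervals share a point of the circle only at their ends, which gives the corners
     [(param j, param j)] and [(param i, param i + 1)]. *)
  have [uv|uv] := eqVneq u v0.
    left; rewrite !inE; move: uv; rewrite /v0; case: ltP => h e.
      have -> : u = param j by lra.
      have -> : v = param j by lra.
      by rewrite !eqxx orbT.
    have -> : u = param i by lra.
    have -> : v = param i + 1 by lra.
    by rewrite !eqxx orbT.
  have [k ku] : exists k, param k = u by apply: (double_point ur v0r uv); rewrite cv.
  have [l lv] : exists l, param l = v0.
    by apply: (double_point v0r ur); rewrite ?cv // eq_sym.
  have mkl : meets k l.
    rewrite /meets ku lv cv euv eqxx andbT; apply: contraNneq uv => e.
    by rewrite -ku -lv e.
  have vE : v = if v < 1 then param l else param l + 1.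
    by rewrite lv /v0; case: (v < 1); lra.
  have ik : (i <= k)%N by rewrite -param_le ku.
  have kj : (k <= j)%N by rewrite -param_le ku.
  have corner : k = i \/ k = j -> u \in [:: param i; param j] /\ v \in [:: param j; param i + 1].
    rewrite !inE -ku vE => -[] e; rewrite e in mkl *.
      have -> : l = j by exact: meets_unique mkl mij.
      rewrite eqxx; case: ltP => h; rewrite ?eqxx //.
      by exfalso; move: vE; rewrite ltNge h /= (meets_unique mkl mij); lra.
    have li : l = i by apply: meets_unique mkl _; rewrite meetsC.
    rewrite eqxx orbT li; case: ltP => h; rewrite ?eqxx ?orbT //.
    by exfalso; move: vE; rewrite h li; lra.
  have [ek|nki] := eqVneq k i; first by left; apply: corner; left.
  have [ek|nkj] := eqVneq k j; first by left; apply: corner; right.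
  have nli : l != i.
    apply: contraNneq nkj => e; rewrite e meetsC in mkl.
    by rewrite (meets_unique mkl mij).
  have nlj : l != j.
    apply: contraNneq nki => e; rewrite e meetsC in mkl; rewrite meetsC in mij.
    by rewrite (meets_unique mkl mij).
  right; exists (k, l).
    rewrite /P /= mkl /= !ltn_neqAle ik kj !andbT.
    have -> : nat_of_ord i != k by apply: contraNneq nki => /val_inj ->.
    have -> : nat_of_ord k != j by apply: contraNneq nkj => /val_inj ->.
    rewrite /=; apply/negP => /andP[il lj].
    have {}il : param i < param l.
      by rewrite param_lt ltn_neqAle il andbT; apply: contraNneq nli => /val_inj ->.
    have {}lj : param l < param j.
      by rewrite param_lt ltn_neqAle lj andbT; apply: contraNneq nlj => /val_inj ->.
    move: vE; case: ifP => _ vE; first by rewrite vE leNgt lj in vj.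
    by rewrite vE lerD2r leNgt il in vi.
  rewrite /U /V /=; split=> //.
  rewrite [LHS]vE -(param_lt l i); have /andP[l0 l1] := param_range l.
  have nl : param l != param i by apply: contraNneq nli => /param_inj ->.
  move: vE; case: (ltP v 1) => h vE; case: (ltP (param l) (param i)) => h' //; exfalso.
    by have := lt_trans h' st; rewrite ltNge -vE vj.
  have : param l <= param i by rewrite vE lerD2r in vi.
  by rewrite le_eqVlt (negbTE nl) /= ltNge h'.
Qed.

End Charts.

(** * Curves on the sphere *)

Section SphericalCurves.
Variable R : realType.

Definition det3 (x1 x2 x3 u1 u2 u3 v1 v2 v3 : R) :=
  x1 * (u2 * v3 - u3 * v2) + x2 * (u3 * v1 - u1 * v3) + x3 * (u1 * v2 - u2 * v1).

Lemma derivable1_continuous (f : R -> R) (t d : R) : is_derive t 1 f d -> {for t, continuous f}.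
Proof.
by case=> /derivable1_diffP /differentiable_continuous.
Qed.

Lemma dot2_continuous (x y dx dy : R -> R) (l : R * R) :
  (forall t : R, is_derive t 1 x (dx t)) -> (forall t : R, is_derive t 1 y (dy t)) ->
  continuous (fun t => dot2 l (x t, y t)).
Proof.
move=> hx hy t; rewrite /dot2 /=.
exact: (@derivable1_continuous _ t (l.1 * dx t + l.2 * dy t)).
Qed.

Variables (x y z dx dy dz : R -> R).
Hypotheses (hx : forall t : R, is_derive t 1 x (dx t))
  (hy : forall t : R, is_derive t 1 y (dy t))
  (hz : forall t : R, is_derive t 1 z (dz t)).
Hypothesis on_sphere : forall t, x t ^+ 2 + y t ^+ 2 + z t ^+ 2 = 1.

Lemma sphere_tangent t : x t * dx t + y t * dy t + z t * dz t = 0.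
Proof.
pose f u := x u * x u + y u * y u + z u * z u.
have h1 : is_derive t 1 f (x t * dx t + x t * dx t + (y t * dy t + y t * dy t)
    + (z t * dz t + z t * dz t)).
  exact: is_deriveD.
have h2 : is_derive t 1 f 0.
  have -> : f = cst 1 by apply/funext => u; rewrite /f -!expr2 on_sphere.
  exact: is_derive_cst.
case: h1 => _ e1; case: h2 => _ e2; rewrite e1 in e2; lra.
Qed.

Section Stereographic.
Variables (q1 q2 q3 : R).
Hypotheses (q_sphere : q1 ^+ 2 + q2 ^+ 2 + q3 ^+ 2 = 1) (q30 : q3 != 0).
Hypothesis q_off : forall t, ~ [/\ x t = q1, y t = q2 & z t = q3].

Definition stereo_den t := 1 - (x t * q1 + y t * q2 + z t * q3).

Let w := stereo_den.

(* Stereographic projection from [q], read off on the first two coordinates;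
   this is a chart since [q3 != 0]. *)
Definition stereo t : R * R := ((x t - q1) / w t, (y t - q2) / w t).

Definition dstereo t : R * R :=
  let dw := - (dx t * q1 + dy t * q2 + dz t * q3) in
  ((dx t * w t - (x t - q1) * dw) / w t ^+ 2,
   (dy t * w t - (y t - q2) * dw) / w t ^+ 2).

(** The squared chord to [q]: hence the denominator vanishes only at [q]. *)
Lemma stereo_denE t :
  (x t - q1) ^+ 2 + (y t - q2) ^+ 2 + (z t - q3) ^+ 2 = 2 * w t.
Proof.
have h := on_sphere t; have hq := q_sphere; rewrite /w /stereo_den.
transitivity ((x t ^+ 2 + y t ^+ 2 + z t ^+ 2) + (q1 ^+ 2 + q2 ^+ 2 + q3 ^+ 2)
  - 2 * (x t * q1 + y t * q2 + z t * q3)); first by ring.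
by rewrite h hq; ring.
Qed.

Lemma stereo_den_neq0 t : w t != 0.
Proof.
apply/eqP => w0; apply: (q_off (t := t)).
have := stereo_denE t; rewrite w0 mulr0 => /eqP.
rewrite !paddr_eq0 ?addr_ge0 ?sqr_ge0 // !sqrf_eq0 !subr_eq0.
by move=> /andP[/andP[/eqP-> /eqP->] /eqP->].
Qed.

Lemma is_derive_quot (f : R -> R) (q t d dw : R) : is_derive t 1 f d -> is_derive t 1 w dw ->
  is_derive t 1 (fun u => (f u - q) / w u) ((d * w t - (f t - q) * dw) / w t ^+ 2).
Proof.
move=> hf hw; have w0 := stereo_den_neq0 t.
have h1 : is_derive t 1 (fun u => f u - q) (d - 0).
  by apply: is_deriveB; exact: is_derive_cst.
have h2 := is_deriveV w0 hw.
apply: (is_derive_eq (is_deriveM h1 h2)).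
by rewrite /GRing.scale /= subr0; field.
Qed.

Lemma is_derive_stereo (t : R) :
  is_derive t 1 (fun u => (stereo u).1) (dstereo t).1 /\
  is_derive t 1 (fun u => (stereo u).2) (dstereo t).2.
Proof.
have hw : is_derive t 1 w (- (dx t * q1 + dy t * q2 + dz t * q3)).
  have -> : w = (fun u => 1 - (q1 * x u + q2 * y u + q3 * z u)).
    by apply/funext => u; rewrite /w /stereo_den; ring.
  have h : is_derive t 1 (fun u => q1 * x u + q2 * y u + q3 * z u)
      (q1 * dx t + q2 * dy t + q3 * dz t).
    exact: is_deriveD (is_deriveD (is_deriveZ _ _) (is_deriveZ _ _)) (is_deriveZ _ _).
  apply: (is_derive_eq (is_deriveB (is_derive_cst _ _ _) h)); ring.
by split; exact: is_derive_quot.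
Qed.

Lemma stereo_has_tangent t : has_tangent stereo t (dstereo t).
Proof. by have [h1 h2] := is_derive_stereo t; exact: has_tangent_derive. Qed.

Lemma stereo_continuous (l : R * R) : continuous (fun t => dot2 l (stereo t)).
Proof.
by apply: (@dot2_continuous (fun u => (stereo u).1) (fun u => (stereo u).2)
  (fun t => (dstereo t).1) (fun t => (dstereo t).2)) => t; have [] := is_derive_stereo t.
Qed.

(** The vector [(p - q) / w] has scalar product -1 with [q], which recovers its third coordinate as
    [q3 != 0]; its squared norm is [2 / w], which recovers [w] and then [p]. *)
Lemma stereo_inj u v : stereo u = stereo v -> [/\ x u = x v, y u = y v & z u = z v].
Proof.
have wu := stereo_den_neq0 u; have wv := stereo_den_neq0 v.
case=> e1 e2.
have e3 : (z u - q3) / w u = (z v - q3) / w v.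
  have E t : q3 * ((z t - q3) / w t) = - 1 - q1 * ((x t - q1) / w t) - q2 * ((y t - q2) / w t).
    have wt := stereo_den_neq0 t.
    have wE : w t = 1 - (x t * q1 + y t * q2 + z t * q3) by [].
    have hq := q_sphere.
    have e : q3 * (z t - q3) = - w t - q1 * (x t - q1) - q2 * (y t - q2) by rewrite wE; lra.
    rewrite -[LHS](mulfK wt) -[RHS](mulfK wt); congr (_ / _); transitivity (q3 * (z t - q3)); [field; exact: wt|rewrite e; field; exact: wt].
  by apply: (mulfI q30); rewrite !E e1 e2.
have K t : ((x t - q1) / w t) ^+ 2 + ((y t - q2) / w t) ^+ 2 + ((z t - q3) / w t) ^+ 2 = 2 / w t.
  have wt := stereo_den_neq0 t.
  rewrite !expr_div_n -!mulrDl stereo_denE; field; exact: wt.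
have ew : w u = w v.
  by apply: invr_inj; apply: (mulfI (_ : 2 != 0 :> R)); rewrite ?pnatr_eq0 // -!K e1 e2 e3.
rewrite ew in e1 e2 e3; have iw : (w v)^-1 != 0 by rewrite invr_eq0.
by split; [apply: (addIr (- q1))|apply: (addIr (- q2))|apply: (addIr (- q3))];
  apply: (mulIf iw).
Qed.

(** Both velocities are orthogonal to the unit vector [p], so their cross product is [la] times [p]
    ([c1], [c2], [c3]). With [M = p - q], the rest is the third coordinate of the expansion of
    [det3(M, u, v) q] in the cross products of [M], [u], [v]. *)
Lemma det2_dstereo t t' : x t = x t' -> y t = y t' -> z t = z t' ->
  det2 (dstereo t) (dstereo t') * w t ^+ 2 =
  - q3 * det3 (x t) (y t) (z t) (dx t) (dy t) (dz t) (dx t') (dy t') (dz t').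
Proof.
move=> ex ey ez.
have h1 := sphere_tangent t; have h2 := sphere_tangent t'.
have hp := on_sphere t; have hq := q_sphere; have wt := stereo_den_neq0 t.
have ew : w t' = w t by rewrite /w /stereo_den ex ey ez.
rewrite /dstereo ew -ex -ey -ez in h2 *; rewrite /det2 /=.
have wE : w t = 1 - (x t * q1 + y t * q2 + z t * q3) by [].
move: wt wE h1 h2 hp.
move: (w t) (x t) (y t) (z t) (dx t) (dy t) (dz t) (dx t') (dy t') (dz t').
move=> W X Y Z u1 u2 u3 v1 v2 v3 W0 WE h1 h2 hp.
pose la := det3 X Y Z u1 u2 u3 v1 v2 v3.
have c1 : u2 * v3 - u3 * v2 = X * la.
  rewrite -[LHS]mul1r -hp.
  transitivity (X * la - (Y * (u3 * (X * v1 + Y * v2 + Z * v3) - v3 * (X * u1 + Y * u2 + Z * u3))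
     - Z * (u2 * (X * v1 + Y * v2 + Z * v3) - v2 * (X * u1 + Y * u2 + Z * u3)))); last first.
    by rewrite h1 h2; ring.
  by rewrite /la /det3; ring.
have c2 : u3 * v1 - u1 * v3 = Y * la.
  rewrite -[LHS]mul1r -hp.
  transitivity (Y * la - (Z * (u1 * (X * v1 + Y * v2 + Z * v3) - v1 * (X * u1 + Y * u2 + Z * u3))
     - X * (u3 * (X * v1 + Y * v2 + Z * v3) - v3 * (X * u1 + Y * u2 + Z * u3)))); last first.
    by rewrite h1 h2; ring.
  by rewrite /la /det3; ring.
have c3 : u1 * v2 - u2 * v1 = Z * la.
  rewrite -[LHS]mul1r -hp.
  transitivity (Z * la - (X * (u2 * (X * v1 + Y * v2 + Z * v3) - v2 * (X * u1 + Y * u2 + Z * u3))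
     - Y * (u1 * (X * v1 + Y * v2 + Z * v3) - v1 * (X * u1 + Y * u2 + Z * u3)))); last first.
    by rewrite h1 h2; ring.
  by rewrite /la /det3; ring.
rewrite -/la.
pose M1 := X - q1; pose M2 := Y - q2; pose M3 := Z - q3.
have wM : W = - (M1 * q1 + M2 * q2 + M3 * q3).
  by rewrite WE -hq /M1 /M2 /M3; ring.
have dm : det3 M1 M2 M3 u1 u2 u3 v1 v2 v3 = la * W.
  transitivity (la - (q1 * (u2 * v3 - u3 * v2) + q2 * (u3 * v1 - u1 * v3) + q3 * (u1 * v2 - u2 * v1))).
    by rewrite /la /det3 /M1 /M2 /M3; ring.
  by rewrite c1 c2 c3 WE; ring.
rewrite -[LHS](mulfK W0) -[RHS](mulfK W0); congr (_ / _); rewrite -[RHS]mulrA -dm -/M1 -/M2.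
transitivity ((u1 * v2 - u2 * v1) * W + (u1 * q1 + u2 * q2 + u3 * q3) * (M1 * v2 - M2 * v1)
  + (v1 * q1 + v2 * q2 + v3 * q3) * (u1 * M2 - u2 * M1)).
  by field.
by rewrite wM /det3; ring.
Qed.

Lemma sgz_det2_dstereo t t' : x t = x t' -> y t = y t' -> z t = z t' ->
  sgz (det2 (dstereo t) (dstereo t')) =
  - sgz q3 * sgz (det3 (x t) (y t) (z t) (dx t) (dy t) (dz t) (dx t') (dy t') (dz t')).
Proof.
move=> ex ey ez; rewrite -sgzN -sgzM -det2_dstereo // sgzM.
by rewrite (gtr0_sgz (_ : 0 < w t ^+ 2)) ?mulr1 // exprn_even_gt0 //= stereo_den_neq0.
Qed.

End Stereographic.

(** * A point of the sphere off the curve *)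

Section MissedPoint.
Variable t0 : R.
Hypothesis immersed : dx t0 ^+ 2 + dy t0 ^+ 2 + dz t0 ^+ 2 != 0.
Hypothesis simple : forall t, t0 < t < t0 + 1 -> ~ [/\ x t = x t0, y t = y t0 & z t = z t0].
Hypothesis periodic : forall t, [/\ x (t + 1) = x t, y (t + 1) = y t & z (t + 1) = z t].

Lemma periodic_reduce t : exists2 u, t0 <= u < t0 + 1 & [/\ x t = x u, y t = y u & z t = z u].
Proof.
have perN (n : nat) v : [/\ x (v + n%:R) = x v, y (v + n%:R) = y v & z (v + n%:R) = z v].
  elim: n => [|n [IH1 IH2 IH3]]; first by rewrite addr0.
  by rewrite -natr1 addrA; have [-> -> ->] := periodic (v + n%:R).
have perZ (m : int) v : [/\ x (v + m%:~R) = x v, y (v + m%:~R) = y v & z (v + m%:~R) = z v].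
  case: m => n; first exact: perN.
  have [e1 e2 e3] := perN n.+1 (v - n.+1%:R).
  by rewrite subrK in e1 e2 e3; rewrite NegzE mulrNz.
exists (t + (- Num.floor (t - t0))%:~R); last by have [-> -> ->] := perZ (- Num.floor (t - t0)) t.
have := floor_itv (t - t0); rewrite intrD mulrNz => /andP[h1 h2].
by apply/andP; split; lra.
Qed.

Let X := x t0. Let Y := y t0. Let Z := z t0.
Let u1 := dx t0. Let u2 := dy t0. Let u3 := dz t0.
Let N := u1 ^+ 2 + u2 ^+ 2 + u3 ^+ 2.

Definition height t := x t * u1 + y t * u2 + z t * u3.

Lemma height_neq0 : exists2 e, 0 < e & forall t, t != t0 -> `|t - t0| < e -> height t != 0.
Proof.
have N0 : 0 < N by rewrite lt_neqAle eq_sym immersed !addr_ge0 ?sqr_ge0.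
have hh : is_derive t0 1 height N.
  have -> : height = (fun t => u1 * x t + u2 * y t + u3 * z t).
    by apply/funext => t; rewrite /height; ring.
  apply: (is_derive_eq (is_deriveD (is_deriveD (is_deriveZ u1 (hx t0)) (is_deriveZ u2 (hy t0)))
    (is_deriveZ u3 (hz t0)))).
  by rewrite /GRing.scale /= /N -/u1 -/u2 -/u3; ring.
have h0 : height t0 = 0 by exact: sphere_tangent.
have N2 : 0 < N / 2 by rewrite divr_gt0.
have /nbhs_ballP[e /= e0 he] := is_derive_approx hh N2.
exists e => // t tt te; apply/eqP => ht.
have := he t; rewrite /ball /= distrC => /(_ te); rewrite h0 ht subr0 sub0r normrN normrM.
have n0 : 0 < `|t - t0| by rewrite normr_gt0 subr_eq0.
rewrite (gtr0_norm N0) mulrC ler_pM2r //; lra.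
Qed.

(* The missed points are those close to [p := (x t0, y t0, z t0)] on the great circle
   through [p] orthogonal to the curve: near [t0] the curve leaves the plane of this
   circle ([height] is nonzero), and away from [t0] it stays at a positive distance. *)
Lemma exists_missed_point : exists q1 q2 q3, q1 ^+ 2 + q2 ^+ 2 + q3 ^+ 2 = 1 /\
  forall t, ~ [/\ x t = q1, y t = q2 & z t = q3].
Proof.
have N0 : 0 < N by rewrite lt_neqAle eq_sym immersed !addr_ge0 ?sqr_ge0.
have [e' e'0 he'] := height_neq0.
pose e := Num.min e' 2^-1.
have e0 : 0 < e by rewrite lt_min e'0 invr_gt0 ltr0n.
have e2 : e <= 2^-1 by rewrite ge_min lexx orbT.
have he t : t != t0 -> `|t - t0| < e -> height t != 0.
  by move=> h1 h2; apply: he' => //; apply: lt_le_trans h2 _; rewrite ge_min lexx.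
pose d t := (x t - X) ^+ 2 + (y t - Y) ^+ 2 + (z t - Z) ^+ 2.
have d_cont : continuous d.
  have cx : continuous x by move=> t; exact: derivable1_continuous (hx t).
  have cy : continuous y by move=> t; exact: derivable1_continuous (hy t).
  have cz : continuous z by move=> t; exact: derivable1_continuous (hz t).
  have sq (f : R -> R) c : continuous f -> continuous (fun t => (f t - c) ^+ 2).
    move=> cf; have -> : (fun t => (f t - c) ^+ 2) = (fun t => (f t - c) * (f t - c)).
      by apply/funext => t; rewrite expr2.
    by move=> t; apply: cvgM; apply: cvgB; (exact: cf || exact: cvg_cst).
  by move=> t; apply: cvgD; [apply: cvgD|]; exact: sq.
have le_ends : t0 + e <= t0 + 1 - e by lra.
have [c cin cmin] := EVT_min le_ends (continuous_subspaceT d_cont).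
have m0 : 0 < d c.
  rewrite lt_neqAle !addr_ge0 ?sqr_ge0 // andbT eq_sym; apply/eqP => /eqP.
  rewrite !paddr_eq0 ?addr_ge0 ?sqr_ge0 // !sqrf_eq0 !subr_eq0.
  move=> /andP[/andP[/eqP e1 /eqP e3] /eqP e4]; apply: (simple (t := c)); last by [].
  by move: cin; rewrite in_itv /= => /andP[h1 h2]; apply/andP; split; lra.
(* The point [q] below is at squared distance [4 * s / (1 + s)] from [p], with [s = ep ^+ 2 * N];
   this [ep] gives [8 * s <= d c], so [q] is closer to [p] than the part of the curve away from
   [t0]. *)
pose ep := Num.min 1 (d c / (8 * N)).
have N8 : 0 < 8 * N by rewrite mulr_gt0.
have ep0 : 0 < ep by rewrite lt_min ltr01 divr_gt0.
have ep1 : ep <= 1 by rewrite ge_min lexx.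
have epN : ep * (8 * N) <= d c by rewrite -ler_pdivlMr // ge_min lexx orbT.
pose s := ep ^+ 2 * N.
have s0 : 0 < s by rewrite mulr_gt0 // exprn_gt0.
have sd : 8 * s <= d c.
  by apply: le_trans epN; rewrite /s expr2 [leLHS](_ : _ = ep * (ep * (8 * N))); [rewrite ler_piMl // mulr_ge0 // ltW | ring].
(* [n] is the cross product of [p] with the velocity, and [q] follows the rational parametrization
   of the great circle through [p] in direction [n]. *)
pose n1 := Y * u3 - Z * u2; pose n2 := Z * u1 - X * u3; pose n3 := X * u2 - Y * u1.
have s1 : 1 + s != 0 by rewrite gt_eqF // addr_gt0.
pose q (P n : R) := ((1 - s) * P + 2 * ep * n) / (1 + s).
have pp : X ^+ 2 + Y ^+ 2 + Z ^+ 2 = 1 by exact: on_sphere.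
have pu : X * u1 + Y * u2 + Z * u3 = 0 by exact: sphere_tangent.
have pn : X * n1 + Y * n2 + Z * n3 = 0 by rewrite /n1 /n2 /n3; ring.
have un : u1 * n1 + u2 * n2 + u3 * n3 = 0 by rewrite /n1 /n2 /n3; ring.
have nn : n1 ^+ 2 + n2 ^+ 2 + n3 ^+ 2 = N.
  transitivity ((X ^+ 2 + Y ^+ 2 + Z ^+ 2) * N - (X * u1 + Y * u2 + Z * u3) ^+ 2).
    by rewrite /n1 /n2 /n3 /N; ring.
  by rewrite pp pu expr0n subr0 mul1r.
have q_sphere : q X n1 ^+ 2 + q Y n2 ^+ 2 + q Z n3 ^+ 2 = 1.
  transitivity (((1 - s) ^+ 2 * (X ^+ 2 + Y ^+ 2 + Z ^+ 2)
     + 4 * ep * (1 - s) * (X * n1 + Y * n2 + Z * n3)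
     + 4 * ep ^+ 2 * (n1 ^+ 2 + n2 ^+ 2 + n3 ^+ 2)) / (1 + s) ^+ 2).
    by rewrite /q; field; exact: s1.
  have -> : 4 * ep ^+ 2 * (n1 ^+ 2 + n2 ^+ 2 + n3 ^+ 2) = 4 * s by rewrite nn /s; ring.
  by rewrite pp pn; field; exact: s1.
have qp : X * q X n1 + Y * q Y n2 + Z * q Z n3 = (1 - s) / (1 + s).
  transitivity (((1 - s) * (X ^+ 2 + Y ^+ 2 + Z ^+ 2) + 2 * ep * (X * n1 + Y * n2 + Z * n3)) / (1 + s)).
    by rewrite /q; field; exact: s1.
  by rewrite pp pn mulr0 addr0 mulr1.
have qu : q X n1 * u1 + q Y n2 * u2 + q Z n3 * u3 = 0.
  transitivity (((1 - s) * (X * u1 + Y * u2 + Z * u3) + 2 * ep * (u1 * n1 + u2 * n2 + u3 * n3)) / (1 + s)).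
    by rewrite /q; field; exact: s1.
  by rewrite pu un !mulr0 addr0 mul0r.
exists (q X n1), (q Y n2), (q Z n3); split=> // t'.
have [t /andP[h1 h2] [-> -> ->]] := periodic_reduce t'.
move=> [e1 e3 e4].
have dE : d t = 4 * s / (1 + s).
  transitivity ((q X n1 ^+ 2 + q Y n2 ^+ 2 + q Z n3 ^+ 2) + (X ^+ 2 + Y ^+ 2 + Z ^+ 2)
     - 2 * (X * q X n1 + Y * q Y n2 + Z * q Z n3)); first by rewrite /d e1 e3 e4; ring.
  by rewrite q_sphere pp qp; field; exact: s1.
have s1p : 0 < 1 + s by rewrite addr_gt0.
have d0 : 0 < d t by rewrite dE divr_gt0 // mulr_gt0.
have dlt : d t < d c.
  apply: lt_le_trans sd; rewrite dE ltr_pdivrMr //; nra.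
have ht : height t = 0 by rewrite /height e1 e3 e4.
have tt : t != t0.
  by apply: contraTneq d0 => ->; rewrite /d !subrr expr0n !addr0 ltxx.
have [near|far] := ltP `|t - t0| e; first by have := he t tt near; rewrite ht eqxx.
rewrite ger0_norm ?subr_ge0 // in far.
have [near|far'] := ltP (t0 + 1 - e) t; last first.
  have : t \in `[t0 + e, t0 + 1 - e] by rewrite in_itv /= far' andbT; lra.
  by move/cmin; rewrite leNgt dlt.
(* Shortly before [t0 + 1], going back one period leads shortly before [t0], where [height] is
   nonzero too. *)
have p1 := periodic (t - 1); rewrite subrK in p1.
have : height (t - 1) != 0.
  by apply: he; [lra|rewrite ltr0_norm; lra].
by rewrite /height; case: p1 => <- <- <-; rewrite -/(height t) ht eqxx.
Qed.

End MissedPoint.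

End SphericalCurves.

(** * Charts for diagrams in the plane and on the sphere *)

Section Diagrams.
Variables (R : realType) (D : knot_diagram R).
Implicit Types i j k l : 'I_(nparam D).

Let coord (a : 'I_3) t := curve D t 0 a.
Let dcoord (a : 'I_3) t := derive1 (curve D) t 0 a.

Lemma is_derive_coord a (t : R) : is_derive t 1 (coord a) (dcoord a t).
Proof.
have dc : derivable (curve D) t 1 by exact: (@curve_smooth R D 0%N t).
have /derivable_mxP/(_ 0 a) da := dc.
apply: DeriveDef; first exact: da.
by rewrite /dcoord derive1E derive_mx // mxE.
Qed.

Lemma derive1_curve_periodic t : derive1 (curve D) (t + 1) = derive1 (curve D) t.
Proof.
have E : (fun h => h^-1 *: (curve D (h + (t + 1)) - curve D (t + 1))) =
    (fun h => h^-1 *: (curve D (h + t) - curve D t)).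
  by apply/funext => h; rewrite addrA !curve_periodic.
by rewrite /derive1 E.
Qed.

Lemma row3P (p q : 'rV[R]_3) :
  p 0 0 = q 0 0 -> p 0 1 = q 0 1 -> p 0 (inord 2) = q 0 (inord 2) -> p = q.
Proof.
move=> e0 e1 e2; apply/rowP; case=> [[|[|[|//]]] hm].
- by rewrite (_ : Ordinal hm = 0) //; apply: val_inj.
- by rewrite (_ : Ordinal hm = 1) //; apply: val_inj.
- by rewrite (_ : Ordinal hm = inord 2) //; apply: val_inj; rewrite /= inordK.
Qed.

Lemma plane_arc_intersection i j : surf D = Plane -> (i < j)%N ->
  curve D (param i) = curve D (param j) ->
  \sum_(k : 'I_(nparam D) | (i < k < j)%N)
    \sum_(l : 'I_(nparam D) | meets k l && ~~ (i <= l <= j)%N) strand_sign k l = 0.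
Proof.
move=> sD.
have om : ord_max = inord 2 :> 'I_3 by apply: val_inj; rewrite /= inordK.
apply: (@chart_arc_intersection _ _ (fun t => (coord 0 t, coord 1 t))
  (fun t => (dcoord 0 t, dcoord 1 t)) 1) => //.
- move=> u v; split=> [[e0 e1]|e]; last by rewrite /coord e.
  apply: row3P => //; have := curve_on_surface D; rewrite sD /= om => h.
  by rewrite !h.
- by move=> u; exact: has_tangent_derive (is_derive_coord 0 u) (is_derive_coord 1 u).
- by move=> u; rewrite /dcoord derive1_curve_periodic.
- by move=> l; exact: dot2_continuous (is_derive_coord 0) (is_derive_coord 1).
- move=> u v _; rewrite mul1r; congr sgz; rewrite orientationE sD /= !mxE om !eqxx.
  have -> : (0 == inord 2 :> 'I_3) = false by rewrite -val_eqE /= inordK.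
  have -> : (1 == inord 2 :> 'I_3) = false by rewrite -val_eqE /= inordK.
  by rewrite /= !(mulr0n, mul0r, add0r) mul1r.
Qed.

(** [a], [b], [c] stand for a cyclic permutation of the coordinates, which preserves [det3] and lets
    a nonzero coordinate of the missed point come last. *)
Lemma sphere_chart_arc_intersection (a b c : 'I_3) (q1 q2 q3 : R) i j :
  (forall t, coord a t ^+ 2 + coord b t ^+ 2 + coord c t ^+ 2 = 1) ->
  (forall p q : 'rV[R]_3, p 0 a = q 0 a -> p 0 b = q 0 b -> p 0 c = q 0 c -> p = q) ->
  (forall p u v : 'rV[R]_3, orientation (surf D) p u v =
     det3 (p 0 a) (p 0 b) (p 0 c) (u 0 a) (u 0 b) (u 0 c) (v 0 a) (v 0 b) (v 0 c)) ->
  q1 ^+ 2 + q2 ^+ 2 + q3 ^+ 2 = 1 -> q3 != 0 ->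
  (forall t, ~ [/\ coord a t = q1, coord b t = q2 & coord c t = q3]) ->
  (i < j)%N -> curve D (param i) = curve D (param j) ->
  \sum_(k : 'I_(nparam D) | (i < k < j)%N)
    \sum_(l : 'I_(nparam D) | meets k l && ~~ (i <= l <= j)%N) strand_sign k l = 0.
Proof.
move=> sph row orE qs q30 off.
have ha := is_derive_coord a; have hb := is_derive_coord b; have hc := is_derive_coord c.
apply: (@chart_arc_intersection _ _ (stereo (coord a) (coord b) (coord c) q1 q2 q3)
  (dstereo (coord a) (coord b) (coord c) (dcoord a) (dcoord b) (dcoord c) q1 q2 q3)
  (- sgz q3)).
- by rewrite oppr_eq0 sgz_eq0.
- move=> u v; split=> [e|e]; last by rewrite /stereo /stereo_den /coord e.
  by have [] := stereo_inj sph qs q30 off e; exact: row.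
- by move=> u; exact: stereo_has_tangent.
- by move=> u; rewrite /dstereo /stereo_den /dcoord /coord derive1_curve_periodic curve_periodic.
- by move=> l; exact: (stereo_continuous ha hb hc sph qs off).
- move=> u v e; rewrite orE; apply: (sgz_det2_dstereo ha hb hc sph qs off); by rewrite /coord e.
Qed.

Lemma sphere_arc_intersection i j : surf D = Sphere -> (i < j)%N ->
  curve D (param i) = curve D (param j) ->
  \sum_(k : 'I_(nparam D) | (i < k < j)%N)
    \sum_(l : 'I_(nparam D) | meets k l && ~~ (i <= l <= j)%N) strand_sign k l = 0.
Proof.
move=> sD ij eij.
pose o2 : 'I_3 := inord 2.
have sph t : coord 0 t ^+ 2 + coord 1 t ^+ 2 + coord o2 t ^+ 2 = 1.
  have := curve_on_surface D t; rewrite sD /= !big_ord_recl big_ord0 addr0 addrA.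
  have -> : lift ord0 (lift ord0 ord0) = o2 by apply: val_inj; rewrite /= inordK.
  by have -> : lift ord0 ord0 = 1 :> 'I_3 by apply: val_inj.
have orE (p u v : 'rV[R]_3) : orientation (surf D) p u v =
    det3 (p 0 0) (p 0 1) (p 0 o2) (u 0 0) (u 0 1) (u 0 o2) (v 0 0) (v 0 1) (v 0 o2).
  by rewrite orientationE sD.
(* Midway between two consecutive double-point parameters the curve has a simple point; [i.+1] is
   available because [i < j]. *)
have hi1 : (i.+1 < nparam D)%N by rewrite (leq_ltn_trans ij).
pose i' := Ordinal hi1.
have ii : param i < param i' by rewrite param_lt.
pose t0 := (param i + param i') / 2.
have /andP[i0 i1] := param_range i; have /andP[i0' i1'] := param_range i'.
have t0i : param i < t0 by rewrite /t0 ltr_pdivlMr //; lra.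
have t0i' : t0 < param i' by rewrite /t0 ltr_pdivrMr //; lra.
have t0r : 0 <= t0 < 1 by apply/andP; split; lra.
have imm : dcoord 0 t0 ^+ 2 + dcoord 1 t0 ^+ 2 + dcoord o2 t0 ^+ 2 != 0.
  apply: contraNneq (curve_immersed D t0) => /eqP.
  rewrite !paddr_eq0 ?addr_ge0 ?sqr_ge0 // !sqrf_eq0 => /andP[/andP[/eqP e0 /eqP e1] /eqP e2].
  by apply/eqP; apply: row3P; rewrite mxE.
have simple t : t0 < t < t0 + 1 ->
    ~ [/\ coord 0 t = coord 0 t0, coord 1 t = coord 1 t0 & coord o2 t = coord o2 t0].
  move=> /andP[h1 h2] [e0 e1 e2]; have e := row3P e0 e1 e2.
  have [s [sr st es]] : exists s, [/\ 0 <= s < 1, t0 != s & curve D t0 = curve D s].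
    have [t1|t1] := ltP t 1.
      by exists t; split; rewrite ?lt_eqF //; apply/andP; split; lra.
    exists (t - 1); split; first by apply/andP; split; lra.
      by rewrite gt_eqF //; lra.
    by rewrite -e -[in LHS](subrK 1 t) curve_periodic.
  have [k kt] := double_point t0r sr st es.
  rewrite -kt param_lt in t0i; rewrite -kt param_lt in t0i'.
  by rewrite /= ltnS leqNgt t0i in t0i'.
have per t : [/\ coord 0 (t + 1) = coord 0 t, coord 1 (t + 1) = coord 1 t
    & coord o2 (t + 1) = coord o2 t] by rewrite /coord curve_periodic.
have [q1 [q2 [q3 [qs off]]]] := exists_missed_point (is_derive_coord 0)
  (is_derive_coord 1) (is_derive_coord o2) sph imm simple per.
have [q30|q30] := eqVneq q3 0; last first.
  exact: (sphere_chart_arc_intersection sph row3P orE qs q30 off ij eij).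
have [q10|q10] := eqVneq q1 0; last first.
  apply: (@sphere_chart_arc_intersection 1 o2 0 q2 q3 q1) => //.
  - by move=> t; rewrite -(sph t); ring.
  - by move=> p q e1 e2 e0; exact: row3P.
  - by move=> p u v; rewrite orE /det3; ring.
  - by rewrite -qs; ring.
  - by move=> t [e1 e2 e3]; exact: (off t).
have q20 : q2 != 0.
  by apply: contra_eq_neq qs => ->; rewrite q10 q30 expr0n !addr0 eq_sym oner_eq0.
apply: (@sphere_chart_arc_intersection o2 0 1 q3 q1 q2) => //.
- by move=> t; rewrite -(sph t); ring.
- by move=> p q e2 e0 e1; exact: row3P.
- by move=> p u v; rewrite orE /det3; ring.
- by rewrite -qs; ring.
- by move=> t [e1 e2 e3]; exact: (off t).
Qed.

Lemma arc_intersection i j : (i < j)%N ->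
  curve D (param i) = curve D (param j) ->
  \sum_(k : 'I_(nparam D) | (i < k < j)%N)
    \sum_(l : 'I_(nparam D) | meets k l && ~~ (i <= l <= j)%N) strand_sign k l = 0.
Proof.
case sD : (surf D); [exact: plane_arc_intersection|exact: sphere_arc_intersection].
Qed.

End Diagrams.

Theorem corollary3p3 (R : realType) (D : knot_diagram R)
  (X : finType) (f : X -> X) (S : X * X -> X * X)
  (hX : virtual_biquandle f S) :
  num_colorings D (virtual_biquandle_rule f S) =
  num_colorings D (biquandle_rule (VR f S)).
Proof.
have [g hg] := Alexander_numbering (@arc_intersection R D).
exact: (num_colorings_VR hX hg).
Qed.
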